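(* Let $k$ be a field and let $R$ be an associative $k$-algebra. Let $\mathsf{mod}(R)$ be the set of isomorphism classes of finitely generated left $R$-modules, and for a subset $\mathcal{X}\subseteq\mathsf{mod}(R)$ put $$\mathsf{K}(\mathcal{X})=\{Y\in\mathsf{mod}(R)\mid X^{\oplus n}\text{ degenerates to }Y^{\oplus n}\text{ for some }X\in\mathcal{X}\text{ and some integer }n>0\}.$$ Then $\mathsf{K}(-)$ is a Kuratowski closure operator on $\mathsf{mod}(R)$, that is, for all subsets $\mathcal{X},\mathcal{Y}$ of $\mathsf{mod}(R)$: (1) $\mathsf{K}(\emptyset)=\emptyset$; (2) $\mathcal{X}\subseteq\mathsf{K}(\mathcal{X})$; (3) $\mathsf{K}(\mathcal{X}\cup\mathcal{Y})=\mathsf{K}(\mathcal{X})\cup\mathsf{K}(\mathcal{Y})$; (4) $\mathsf{K}(\mathsf{K}(\mathcal{X}))=\mathsf{K}(\mathcal{X})$. In particular, it induces a topology on $\mathsf{mod}(R)$, in which a subset $\mathcal{X}$ is closed if and only if $\mathsf{K}(\mathcal{X})=\mathcal{X}$, if and only if $\mathcal{X}=\mathsf{K}(\mathcal{Y})$ for some subset $\mathcal{Y}$ of $\mathsf{mod}(R)$. Consequently, when $R$ is a Cohen--Macaulay local ring with coefficient field $k$, the set $\mathsf{E}(d)\subseteq\mathsf{mod}(R)$ of isomorphism classes of maximal Cohen--Macaulay $R$-modules of multiplicity $d$ is equipped with a relative topology for each integer $d>0$.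
   Context: Degeneration: let $V=k[t]_{(t)}$ be the localization of the polynomial ring $k[t]$ at $(t)$, and let $K=k(t)$ be its quotient field. For finitely generated left $R$-modules $M,N$, one says that $M$ degenerates to $N$ if there exists a finitely generated left $R\otimes_k V$-module $Q$ such that $Q$ is flat as a $V$-module, $Q/tQ\cong N$ as an $R$-module, and $Q_t\cong M\otimes_k K$ as an $R\otimes_k K$-module ($Q_t$ denotes the localization of $Q$ inverting $t$). $M^{\oplus n}$ is the direct sum of $n$ copies of $M$. Modules are identified with their isomorphism classes. Multiplicity means Hilbert--Samuel multiplicity $\mathrm{e}(-)$. *)

(* Defs.v *)
From HB Require Import structures.
From mathcomp Require Import all_boot all_order all_algebra.
From mathcomp Require Import all_classical.
From mathcomp Require Import topology normedtype sequences.
From mathcomp Require Import zify.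

Set Implicit Arguments.
Unset Strict Implicit.
Unset Printing Implicit Defensive.

Import GRing.Theory.

Local Open Scope ring_scope.
Local Open Scope quotient_scope.

Section Modules.
Variable A : pzRingType.

Definition fin_gen (M : lmodType A) : Prop :=
  exists n (x : 'I_n -> M), forall y, exists c : 'I_n -> A,
    y = \sum_i c i *: x i.

Definition mod_iso (M N : lmodType A) : Prop :=
  exists f : {linear M -> N}, bijective f.

Lemma mod_iso_refl M : mod_iso M M.
Proof. by exists (@idfun M); exists idfun. Qed.

Lemma mod_iso_sym M N : mod_iso M N -> mod_iso N M.
Proof.
case=> f [g fK gK].
have gl : linear g by move=> a x y; apply: (can_inj fK); rewrite linearP !gK.
pose g' : {linear N -> M} :=
  HB.pack g (GRing.isLinear.Build A N M *:%R g gl).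
by exists g'; exists f.
Qed.

Lemma mod_iso_trans M N P : mod_iso M N -> mod_iso N P -> mod_iso M P.
Proof. by case=> f bf [g bg]; exists (g \o f); apply: bij_comp. Qed.

(* [submodClosed M] is the type of submodules of [M]; it does not inherit from
   [zmodClosed M] in the library. *)
Section Quotient.
Variables (M : lmodType A) (N : submodClosed M).

Lemma submod_opp : oppr_closed N.
Proof. by move=> x Nx; rewrite -scaleN1r rpredZ. Qed.

Definition submod_zmod : zmodClosed M :=
  HB.pack (GRing.SubmodClosed.sort N) (GRing.isOppClosed.Build M (GRing.SubmodClosed.sort N) submod_opp).

Definition quotmod : Type := Quotient.quot submod_zmod.
HB.instance Definition _ := GRing.Zmodule.on quotmod.
HB.instance Definition _ :=
  EqQuotient.copy quotmod (Quotient.quot submod_zmod).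

Definition quotmod_scale (a : A) (x : quotmod) : quotmod :=
  \pi_quotmod (a *: repr x).

Lemma quotmodP (x y : M) : reflect (\pi_quotmod x = \pi_quotmod y) (x - y \in N).
Proof. by rewrite -[_ \in _]/(x - y \in submod_zmod) Quotient.idealrBE; exact: eqP. Qed.

Lemma quotmod_scaleE a x : quotmod_scale a (\pi_quotmod x) = \pi_quotmod (a *: x).
Proof.
rewrite /quotmod_scale; apply/quotmodP.
have h : repr (\pi_quotmod x) - x \in N by apply/quotmodP; rewrite reprK.
by rewrite -scalerBr rpredZ.
Qed.

Lemma quotmodD x y : \pi_quotmod (x + y) = \pi_quotmod x + \pi_quotmod y.
Proof. by rewrite !piE. Qed.

Fact quotmod_scaleA a b x :
  quotmod_scale a (quotmod_scale b x) = quotmod_scale (a * b) x.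
Proof.
elim/quotW: x => x; rewrite [quotmod_scale b _]quotmod_scaleE.
by rewrite !quotmod_scaleE scalerA.
Qed.
Fact quotmod_scale1 : left_id 1 quotmod_scale.
Proof. by elim/quotW => x; rewrite quotmod_scaleE scale1r. Qed.
Fact quotmod_scaleDr : right_distributive quotmod_scale +%R.
Proof.
move=> a; elim/quotW => x; elim/quotW => y.
by rewrite -quotmodD !quotmod_scaleE -quotmodD scalerDr.
Qed.
Fact quotmod_scaleDl x : {morph quotmod_scale^~ x : a b / a + b}.
Proof.
by elim/quotW: x => x a b; rewrite !quotmod_scaleE -quotmodD scalerDl.
Qed.
HB.instance Definition _ := GRing.Zmodule_isLmodule.Build A quotmod
  quotmod_scaleA quotmod_scale1 quotmod_scaleDr quotmod_scaleDl.

Lemma quotmodZ a x : \pi_quotmod (a *: x) = a *: \pi_quotmod x.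
Proof. exact/esym/quotmod_scaleE. Qed.

End Quotient.

Section Span.
Variable M : lmodType A.

Definition span_pred (X : set M) : pred M :=
  fun y => `[< exists s : seq (A * M),
    (forall p, p \in s -> X p.2) /\ y = \sum_(p <- s) p.1 *: p.2 >].

Lemma span_predP (X : set M) y : reflect (exists s : seq (A * M),
    (forall p, p \in s -> X p.2) /\ y = \sum_(p <- s) p.1 *: p.2) (y \in span_pred X).
Proof. exact: asboolP. Qed.

Fact span_submod (X : set M) : subsemimod_closed (span_pred X).
Proof.
split; first split.
- by apply/span_predP; exists [::]; split=> //; rewrite big_nil.
- move=> x y /span_predP[s [sX ->]] /span_predP[t [tX ->]]; apply/span_predP.
  exists (s ++ t); split; last by rewrite big_cat.
  by move=> p; rewrite mem_cat => /orP[/sX|/tX].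
- move=> a x /span_predP[s [sX ->]]; apply/span_predP.
  exists [seq (a * p.1, p.2) | p <- s]; split.
    by move=> _ /mapP[p ps ->]; apply: (sX p).
  by rewrite big_map scaler_sumr; apply: eq_bigr => p _; rewrite scalerA.
Qed.

Definition span (X : set M) : submodClosed M :=
  HB.pack (span_pred X)
    (GRing.isSubSemiModClosed.Build A M (span_pred X) (span_submod X)).

End Span.
End Modules.

Arguments quotmod {A M} N.

Definition restr (S A : pzRingType) (f : {rmorphism S -> A})
  (M : lmodType A) : Type := M.

Section Restriction.
Variables (S A : pzRingType) (f : {rmorphism S -> A}) (M : lmodType A).
Local Notation restr := (restr f M).
HB.instance Definition _ := GRing.Zmodule.on restr.

Definition restr_scale (s : S) (x : restr) : restr := f s *: (x : M).

Fact restr_scaleA a b x :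
  restr_scale a (restr_scale b x) = restr_scale (a * b) x.
Proof. by rewrite /restr_scale scalerA rmorphM. Qed.
Fact restr_scale1 : left_id 1 restr_scale.
Proof. by move=> x; rewrite /restr_scale rmorph1 scale1r. Qed.
Fact restr_scaleDr : right_distributive restr_scale +%R.
Proof. by move=> a x y; rewrite /restr_scale scalerDr. Qed.
Fact restr_scaleDl x : {morph restr_scale^~ x : a b / a + b}.
Proof. by move=> a b; rewrite /restr_scale rmorphD scalerDl. Qed.
HB.instance Definition _ := GRing.Zmodule_isLmodule.Build S restr
  restr_scaleA restr_scale1 restr_scaleDr restr_scaleDl.

End Restriction.

Section Tensor.
Variables (S : comPzRingType) (M N : lmodType S).

Definition balanced (W : zmodType) (f : M -> N -> W) : Prop :=
  [/\ forall n, {morph f^~ n : x y / x + y},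
      forall m, {morph f m : x y / x + y}
    & forall s m n, f (s *: m) n = f m (s *: n)].

Definition tens_val (W : zmodType) (f : M -> N -> W) (u : seq (M * N)) : W :=
  \sum_(p <- u) f p.1 p.2.

(* A formal sum of pure tensors is represented by the sequence of its terms;
   two formal sums are equal in the tensor product iff no balanced map
   separates them. *)
Definition tens_eq (u v : seq (M * N)) : bool :=
  `[< forall (W : zmodType) (f : M -> N -> W), balanced f ->
      tens_val f u = tens_val f v >].

Fact tens_eq_equiv : equiv_class_of tens_eq.
Proof.
split=> [u|u v|v u w].
- exact/asboolP.
- by apply/idP/idP => /asboolP h; apply/asboolP => W f bf; rewrite h.
- move=> /asboolP h1 /asboolP h2; apply/asboolP => W f bf.
  by rewrite h1 // h2.
Qed.
Canonical tens_eq_equivRel := EquivRelPack tens_eq_equiv.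
Canonical tens_eq_encModRel := defaultEncModRel tens_eq.

Definition tens : Type := {eq_quot tens_eq}.
HB.instance Definition _ := Choice.on tens.
HB.instance Definition _ : EqQuotient _ tens_eq tens := EqQuotient.on tens.

Lemma tensP (u v : seq (M * N)) :
  \pi_tens u = \pi_tens v <->
  (forall (W : zmodType) (f : M -> N -> W), balanced f ->
      tens_val f u = tens_val f v).
Proof.
split=> [/eqmodP /asboolP //|h]; apply/eqmodP; exact/asboolP.
Qed.

Definition tens_lift (W : zmodType) (f : M -> N -> W) (x : tens) : W :=
  tens_val f (repr x).

Lemma tens_liftE (W : zmodType) (f : M -> N -> W) u : balanced f ->
  tens_lift f (\pi_tens u) = tens_val f u.
Proof. by move=> bf; apply/(tensP _ u).1 => //; rewrite reprK. Qed.

Definition tens_add (x y : tens) : tens := \pi_tens (repr x ++ repr y).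
Definition tens_opp (x : tens) : tens :=
  \pi_tens [seq (- p.1, p.2) | p <- repr x].

Lemma tens_addE u v : tens_add (\pi_tens u) (\pi_tens v) = \pi_tens (u ++ v).
Proof.
apply/tensP => W f bf; rewrite /tens_val !big_cat /=.
by congr (_ + _); rewrite -[LHS]/(tens_lift f _) tens_liftE.
Qed.

Lemma balanced0l (W : zmodType) (f : M -> N -> W) n : balanced f -> f 0 n = 0.
Proof.
by case=> fl _ _; apply: (addrI (f 0 n)); rewrite -fl !addr0.
Qed.

Fact tens_addA : associative tens_add.
Proof.
elim/quotW=> u; elim/quotW=> v; elim/quotW=> w.
by rewrite (tens_addE u v) (tens_addE v w) !tens_addE catA.
Qed.
Fact tens_addC : commutative tens_add.
Proof.
elim/quotW=> u; elim/quotW=> v; rewrite !tens_addE; apply/tensP => W f bf.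
by rewrite /tens_val !big_cat /= addrC.
Qed.
Fact tens_add0 : left_id (\pi_tens [::]) tens_add.
Proof. by elim/quotW=> u; rewrite tens_addE. Qed.
Fact tens_addN : left_inverse (\pi_tens [::]) tens_opp tens_add.
Proof.
move=> x; rewrite -{2}[x]reprK tens_addE; apply/tensP => W f bf.
rewrite /tens_val big_cat big_map big_nil /= -big_split big1 // => p _ /=.
by case: (bf) => fl _ _; rewrite -fl addNr balanced0l.
Qed.
HB.instance Definition _ := GRing.isZmodule.Build tens
  tens_addA tens_addC tens_add0 tens_addN.

Definition pure (m : M) (n : N) : tens := \pi_tens [:: (m, n)].

Lemma pure_balanced : balanced pure.
Proof.
split=> [n x y|m x y|s m n]; rewrite ?[RHS]tens_addE;
  apply/tensP => W f [fl fr fs]; rewrite /tens_val /= !big_cons !big_nil /=.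
- by rewrite fl !addr0.
- by rewrite fr !addr0.
- by rewrite fs.
Qed.

Lemma tens_pureE u : \pi_tens u = \sum_(p <- u) pure p.1 p.2.
Proof.
elim: u => [|[m n] u IH]; first by rewrite big_nil.
by rewrite big_cons -IH [RHS]tens_addE.
Qed.

Lemma tens_ind (P : tens -> Prop) :
  P 0 -> (forall m n x, P x -> P (pure m n + x)) -> forall x, P x.
Proof.
move=> P0 PD x; rewrite -[x]reprK tens_pureE.
by elim: (repr x) => [|p u IH]; rewrite ?big_nil // big_cons; apply: PD.
Qed.

Section Lift.
Variables (W : zmodType) (f : M -> N -> W).
Hypothesis bf : balanced f.

Lemma tens_lift_pure m n : tens_lift f (pure m n) = f m n.
Proof. by rewrite tens_liftE // /tens_val big_cons big_nil addr0. Qed.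

Lemma tens_liftD : {morph tens_lift f : x y / x + y}.
Proof.
move=> x y; rewrite -[x]reprK -[y]reprK [X in tens_lift f X]tens_addE.
by rewrite !tens_liftE // /tens_val big_cat.
Qed.

Lemma tens_lift0 : tens_lift f 0 = 0.
Proof. by rewrite [X in tens_lift f X]tens_pureE -tens_pureE tens_liftE // /tens_val big_nil. Qed.

End Lift.

Lemma tens_lift_fD (W : zmodType) (f g : M -> N -> W) x :
  tens_lift (fun m n => f m n + g m n) x = tens_lift f x + tens_lift g x.
Proof. exact: big_split. Qed.

Lemma eq_tens_lift (W : zmodType) (f g : M -> N -> W) : f =2 g ->
  tens_lift f =1 tens_lift g.
Proof. by move=> fg x; apply: eq_bigr => p _; rewrite fg. Qed.

Lemma tens_lift_ext (W : zmodType) (f g : tens -> W) :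
  {morph f : x y / x + y} -> {morph g : x y / x + y} ->
  (forall m n, f (pure m n) = g (pure m n)) -> f =1 g.
Proof.
move=> fD gD fg; elim/tens_ind => [|m n x IH]; last by rewrite fD gD fg IH.
have z (h : tens -> W) : {morph h : x y / x + y} -> h 0 = 0.
  by move=> hD; apply: (addrI (h 0)); rewrite -hD !addr0.
by rewrite !z.
Qed.

End Tensor.

Section TensorMap.
Variables (S : comPzRingType) (M M' N N' : lmodType S).

(* Meaningful for linear [f] and [g] only. *)
Definition tens_map (f : M -> M') (g : N -> N') : tens M N -> tens M' N' :=
  tens_lift (fun m n => pure (f m) (g n)).

Section Linear.
Variables (f : M -> M') (g : N -> N').
Hypotheses (fL : linear f) (gL : linear g).

Lemma tens_map_balanced : balanced (fun m n => pure (f m) (g n)).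
Proof.
have [bl br bs] := pure_balanced M' N'.
pose f' : {linear M -> M'} := HB.pack f (GRing.isLinear.Build S M M' *:%R f fL).
pose g' : {linear N -> N'} := HB.pack g (GRing.isLinear.Build S N N' *:%R g gL).
split=> [n x y|m x y|s m n].
- by rewrite -bl; congr (pure _ _); exact: (linearD f').
- by rewrite -br; congr (pure _ _); exact: (linearD g').
- have fZ : f (s *: m) = s *: f m := linearZ_LR f' s m.
  have gZ : g (s *: n) = s *: g n := linearZ_LR g' s n.
  by rewrite fZ gZ bs.
Qed.

Lemma tens_map_pure m n : tens_map f g (pure m n) = pure (f m) (g n).
Proof. exact: (tens_lift_pure tens_map_balanced). Qed.

Lemma tens_mapD : {morph tens_map f g : x y / x + y}.
Proof. exact: (tens_liftD tens_map_balanced). Qed.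
End Linear.
End TensorMap.

Definition flat (S : comPzRingType) (M : lmodType S) : Prop :=
  forall (N N' : lmodType S) (f : {linear N -> N'}),
    injective f -> injective (tens_map (@idfun M) f : tens M N -> tens M N').

Section TensorAlgebra.
Variables (k : fieldType) (A B : algType k).

Definition tensalg : Type := tens A B.
HB.instance Definition _ := GRing.Zmodule.on tensalg.

Section Action.
Variables (Z : zmodType) (act : A -> B -> Z -> Z).

Definition tens_act (x : tensalg) (z : Z) : Z :=
  tens_lift (fun a b => act a b z) x.

Hypothesis act_bal : forall z, balanced (fun a b => act a b z).
Hypothesis actD : forall a b, {morph act a b : y z / y + z}.

Lemma tens_act_pure a b z : tens_act (pure a b) z = act a b z.
Proof. exact: (tens_lift_pure (act_bal z)). Qed.

Lemma tens_actDl z : {morph tens_act^~ z : x y / x + y}.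
Proof. exact: (tens_liftD (act_bal z)). Qed.

Lemma tens_actDr x : {morph tens_act x : y z / y + z}.
Proof.
move=> y z; rewrite -[RHS]tens_lift_fD.
by apply: eq_tens_lift => a b; rewrite actD.
Qed.
End Action.

Section Multiplication.
Let mulab (a : A) (b : B) : tensalg -> tensalg :=
  tens_map (fun x : A => a * x) (fun y : B => b * y).

Let mulL (C : algType k) (c : C) : linear (fun x : C => c * x).
Proof. by move=> s x y; rewrite mulrDr scalerAr. Qed.

Let mulab_pure a b x y : mulab a b (pure x y) = pure (a * x) (b * y).
Proof. exact: (tens_map_pure (mulL a) (mulL b)). Qed.

Let mulabD a b : {morph mulab a b : y z / y + z}.
Proof. exact: (tens_mapD (mulL a) (mulL b)). Qed.

Let mulab_bal z : balanced (fun (a : A) (b : B) => mulab a b z).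
Proof.
have [bl br bs] := pure_balanced A B.
split=> [b x y|a x y|s a b]; move: z; apply: tens_lift_ext => [u v|u v|m n];
  rewrite ?mulabD ?mulab_pure //.
- by rewrite addrACA.
- by rewrite mulrDl bl.
- by rewrite addrACA.
- by rewrite mulrDl br.
- by rewrite -!scalerAl bs.
Qed.

Definition tensalg_mul : tensalg -> tensalg -> tensalg := tens_act mulab.

Lemma tensalg_mul_pure a b x y :
  tensalg_mul (pure a b) (pure x y) = pure (a * x) (b * y).
Proof. by rewrite /tensalg_mul tens_act_pure ?mulab_pure. Qed.

Fact tensalg_mulDl : left_distributive tensalg_mul +%R.
Proof. by move=> x y z; apply: tens_actDl mulab_bal z x y. Qed.
Fact tensalg_mulDr : right_distributive tensalg_mul +%R.
Proof. by move=> x y z; apply: tens_actDr mulabD x y z. Qed.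

Fact tensalg_mulA : associative tensalg_mul.
Proof.
move=> x y z; move: x; apply: tens_lift_ext => [u v|u v|a b].
- by rewrite tensalg_mulDl.
- by rewrite !tensalg_mulDl.
move: y; apply: tens_lift_ext => [u v|u v|c d].
- by rewrite tensalg_mulDl tensalg_mulDr.
- by rewrite tensalg_mulDr tensalg_mulDl.
move: z; apply: tens_lift_ext => [u v|u v|e f].
- by rewrite !tensalg_mulDr.
- by rewrite !tensalg_mulDr.
by rewrite !tensalg_mul_pure !mulrA.
Qed.
Fact tensalg_mul1 : left_id (pure 1 1 : tensalg) tensalg_mul.
Proof.
apply: tens_lift_ext => [u v|u v|a b] //; first by rewrite tensalg_mulDr.
by rewrite tensalg_mul_pure !mul1r.
Qed.
Fact tensalg_mulr1 : right_id (pure 1 1 : tensalg) tensalg_mul.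
Proof.
apply: tens_lift_ext => [u v|u v|a b] //; first by rewrite tensalg_mulDl.
by rewrite tensalg_mul_pure !mulr1.
Qed.
HB.instance Definition _ := GRing.Zmodule_isPzRing.Build tensalg
  tensalg_mulA tensalg_mul1 tensalg_mulr1 tensalg_mulDl tensalg_mulDr.

Lemma pureM a b x y :
  (pure a b : tensalg) * (pure x y : tensalg) = pure (a * x) (b * y).
Proof. exact: tensalg_mul_pure. Qed.

End Multiplication.

Definition tens_inl (a : A) : tensalg := pure a 1.
Definition tens_inr (b : B) : tensalg := pure 1 b.

Fact tens_inl_zmod : zmod_morphism tens_inl.
Proof.
have [bl _ _] := pure_balanced A B.
move=> x y; apply/(canRL (addrK _)).
by rewrite -[X in X = _]bl subrK.
Qed.
Fact tens_inl_monoid : monoid_morphism tens_inl.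
Proof. by split=> // x y; rewrite pureM mulr1. Qed.
HB.instance Definition _ :=
  GRing.isZmodMorphism.Build A tensalg tens_inl tens_inl_zmod.
HB.instance Definition _ :=
  GRing.isMonoidMorphism.Build A tensalg tens_inl tens_inl_monoid.

Fact tens_inr_zmod : zmod_morphism tens_inr.
Proof.
have [_ br _] := pure_balanced A B.
move=> x y; apply/(canRL (addrK _)).
by rewrite -[X in X = _]br subrK.
Qed.
Fact tens_inr_monoid : monoid_morphism tens_inr.
Proof. by split=> // x y; rewrite pureM mulr1. Qed.
HB.instance Definition _ :=
  GRing.isZmodMorphism.Build B tensalg tens_inr tens_inr_zmod.
HB.instance Definition _ :=
  GRing.isMonoidMorphism.Build B tensalg tens_inr tens_inr_monoid.

(* An [A (x) B]-module from commuting actions of [A] and [B]. *)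
Section ActionModule.
Variables (Z : zmodType) (act : A -> B -> Z -> Z).
Hypothesis act_bal : forall z, balanced (fun a b => act a b z).
Hypothesis actD : forall a b, {morph act a b : y z / y + z}.
Hypothesis act1 : forall z, act 1 1 z = z.
Hypothesis actM : forall a b c d z,
  act (a * c) (b * d) z = act a b (act c d z).

Lemma tens_actA x y z :
  tens_act act x (tens_act act y z) = tens_act act (x * y) z.
Proof.
have Dl := tens_actDl act_bal; have Dr := tens_actDr actD.
move: x; apply: tens_lift_ext => [u v|u v|a b]; rewrite ?mulrDl ?Dl //.
move: y; apply: tens_lift_ext => [u v|u v|c d]; rewrite ?mulrDr ?Dl ?Dr //.
by rewrite pureM !(tens_act_pure act_bal) actM.
Qed.

Lemma tens_act1 z : tens_act act 1 z = z.
Proof. by rewrite (tens_act_pure act_bal). Qed.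
End ActionModule.

Section TensorModule.
Variables (M : lmodType A) (N : lmodType B).

Local Notation Mk := (restr (in_alg A) M).
Local Notation Nk := (restr (in_alg B) N).

(* [M (x)_k N] as a module over [A (x)_k B]. *)
Definition tensmod : Type := tens Mk Nk.
HB.instance Definition _ := GRing.Zmodule.on tensmod.

Definition mpure (m : M) (n : N) : tensmod := pure (m : Mk) (n : Nk).

Let scaleA (C : algType k) (P : lmodType C) (c : C)
  (x : restr (in_alg C) P) : restr (in_alg C) P := c *: (x : P).

Let act (a : A) (b : B) : tensmod -> tensmod :=
  tens_map (@scaleA A M a) (@scaleA B N b).

Let scaleA_linear (C : algType k) (P : lmodType C) (c : C) :
  linear (@scaleA C P c).
Proof.
move=> s x y; rewrite /scaleA scalerDr; congr (_ + _).
by rewrite -[s *: x]/(s%:A *: (x : P)) scalerA mulr_algr -mulr_algl -scalerA.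
Qed.

Let act_pure a b x y : act a b (mpure x y) = mpure (a *: x) (b *: y).
Proof. exact: (tens_map_pure (scaleA_linear a) (scaleA_linear b)). Qed.

Let actD a b : {morph act a b : y z / y + z}.
Proof. exact: (tens_mapD (scaleA_linear a) (scaleA_linear b)). Qed.

Let act_bal z : balanced (fun (a : A) (b : B) => act a b z).
Proof.
have [bl br bs] := pure_balanced Mk Nk.
split=> [b x y|a x y|s a b]; move: z; apply: tens_lift_ext => [u v|u v|m n];
  rewrite ?actD ?[act _ _ (pure m n)]act_pure //.
- by rewrite addrACA.
- by rewrite scalerDl; apply: bl.
- by rewrite addrACA.
- by rewrite scalerDl; apply: br.
- by rewrite -[s *: a]mulr_algl -[s *: b]mulr_algl -!scalerA; apply: bs.
Qed.

Let act1 z : act 1 1 z = z.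
Proof.
move: z; apply: tens_lift_ext => [u v|//|m n]; first by rewrite actD.
by rewrite [LHS]act_pure !scale1r.
Qed.

Let actM a b c d z : act (a * c) (b * d) z = act a b (act c d z).
Proof.
move: z; apply: tens_lift_ext => [u v|u v|m n]; rewrite ?actD //.
by rewrite ![act _ _ (pure m n)]act_pure act_pure !scalerA.
Qed.

HB.instance Definition _ := GRing.Zmodule_isLmodule.Build tensalg tensmod
  (tens_actA act_bal actD actM) (tens_act1 act_bal act1)
  (tens_actDr actD) (tens_actDl act_bal).

Lemma tensmod_pureE a b m n :
  (pure a b : tensalg) *: mpure m n = mpure (a *: m) (b *: n).
Proof. by rewrite -act_pure -(tens_act_pure act_bal). Qed.

End TensorModule.
End TensorAlgebra.

Arguments tens_inl {k} A B a.
Arguments tens_inr {k} A B b.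

Notation "x %:F" := (@tofrac _ x) : ring_scope.

(* The field [k(t)], as a [k]-algebra. *)
Definition ratfun (k : fieldType) : Type := {fraction {poly k}}.

Section RationalFunctions.
Variable k : fieldType.
HB.instance Definition _ := GRing.Field.on (ratfun k).

Definition ratfun_scale (c : k) (x : ratfun k) : ratfun k := (c%:P)%:F * x.

Fact ratfun_scaleA a b x :
  ratfun_scale a (ratfun_scale b x) = ratfun_scale (a * b) x.
Proof. by rewrite /ratfun_scale mulrA -tofracM polyCM. Qed.
Fact ratfun_scale1 : left_id 1 ratfun_scale.
Proof. by move=> x; rewrite /ratfun_scale tofrac1 mul1r. Qed.
Fact ratfun_scaleDr : right_distributive ratfun_scale +%R.
Proof. by move=> a x y; rewrite /ratfun_scale mulrDr. Qed.
Fact ratfun_scaleDl x : {morph ratfun_scale^~ x : a b / a + b}.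
Proof. by move=> a b; rewrite /ratfun_scale polyCD tofracD mulrDl. Qed.
HB.instance Definition _ := GRing.Zmodule_isLmodule.Build k (ratfun k)
  ratfun_scaleA ratfun_scale1 ratfun_scaleDr ratfun_scaleDl.

Fact ratfun_scaleAl (a : k) (x y : ratfun k) : a *: (x * y) = (a *: x) * y.
Proof. exact: mulrA. Qed.
HB.instance Definition _ :=
  GRing.Lmodule_isLalgebra.Build k (ratfun k) ratfun_scaleAl.
HB.instance Definition _ := GRing.Lalgebra_isComAlgebra.Build k (ratfun k).

(* The localization [k[t]_(t)]: fractions whose denominator is not in [(t)]. *)
Definition loc0_pred : pred (ratfun k) := fun x =>
  `[< exists p q : {poly k}, q.[0] != 0 /\ x = p%:F / q%:F >].

Lemma loc0P (x : ratfun k) : reflect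
  (exists p q : {poly k}, q.[0] != 0 /\ x = p%:F / q%:F) (x \in loc0_pred).
Proof. exact: asboolP. Qed.

Lemma tofrac_neq0 (q : {poly k}) : q.[0] != 0 -> q%:F != 0 :> ratfun k.
Proof. by move=> q0; rewrite tofrac_eq0; apply: contraNneq q0 => ->; rewrite horner0. Qed.

Fact loc0_subalg : subalg_closed loc0_pred.
Proof.
split.
- by apply/loc0P; exists 1, 1; rewrite hornerC oner_eq0 divr1 tofrac1.
- move=> a x y /loc0P[p [q [q0 ->]]] /loc0P[p' [q' [q'0 ->]]]; apply/loc0P.
  exists (a%:P * p * q' + p' * q), (q * q'); rewrite hornerM mulf_neq0 //.
  split=> //; rewrite tofracD !tofracM -[_ *: _]/(a%:P%:F * (p%:F / q%:F)).
  by rewrite mulrA addf_div ?tofrac_neq0.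
- move=> x y /loc0P[p [q [q0 ->]]] /loc0P[p' [q' [q'0 ->]]]; apply/loc0P.
  exists (p * p'), (q * q'); rewrite hornerM mulf_neq0 //.
  by split=> //; rewrite !tofracM mulf_div.
Qed.
HB.instance Definition _ := GRing.isSubalgClosed.Build k (ratfun k) loc0_pred
  (GRing.subalg_closed_semi loc0_subalg).

Record loc0 : Type := Loc0 { loc0_val :> ratfun k; _ : loc0_val \in loc0_pred }.
HB.instance Definition _ := [isSub for loc0_val].
HB.instance Definition _ := [Choice of loc0 by <:].
HB.instance Definition _ := [SubChoice_isSubComNzRing of loc0 by <:].
HB.instance Definition _ := GRing.SubZmodule_isSubLmodule.Build
  k (ratfun k) loc0_pred loc0 (GRing.subsemimodClosedP _).
HB.instance Definition _ := GRing.SubNzRing_SubLmodule_isSubLalgebra.Build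
  k (ratfun k) loc0_pred loc0.
HB.instance Definition _ := GRing.SubLalgebra_isSubAlgebra.Build
  k (ratfun k) loc0_pred loc0.

Definition ratfun_t : ratfun k := 'X%:F.

Fact ratfun_t_loc0 : ratfun_t \in loc0_pred.
Proof. by apply/loc0P; exists 'X, 1; rewrite hornerC oner_eq0 tofrac1 divr1. Qed.

Definition loc0_t : loc0 := Loc0 ratfun_t_loc0.

Lemma loc0_val_inj : injective loc0_val. Proof. exact: val_inj. Qed.
Lemma loc0_valD x y : loc0_val (x + y) = loc0_val x + loc0_val y.
Proof. exact: (rmorphD (val : loc0 -> ratfun k)). Qed.
Lemma loc0_valM x y : loc0_val (x * y) = loc0_val x * loc0_val y.
Proof. exact: (rmorphM (val : loc0 -> ratfun k)). Qed.
Lemma loc0_valX x n : loc0_val (x ^+ n) = loc0_val x ^+ n.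
Proof. exact: (rmorphXn (val : loc0 -> ratfun k)). Qed.
Lemma loc0_val1 : loc0_val 1 = 1.
Proof. exact: (rmorph1 (val : loc0 -> ratfun k)). Qed.
Lemma loc0_valZ c x : loc0_val (c *: x) = c *: loc0_val x.
Proof. exact: (linearZ_LR (val : loc0 -> ratfun k)). Qed.

Lemma ratfunP (x : ratfun k) :
  exists p q : {poly k}, q != 0 /\ x = p%:F / q%:F.
Proof.
have [r ->] : exists r : {ratio {poly k}}, x = \pi_(FracField.type {poly k}) r.
  by exists (repr x); rewrite reprK.
exists (frac r).1, (frac r).2; split; first exact: denom_ratioP.
apply: (canRL (mulfK _)); first by rewrite tofrac_eq0 denom_ratioP.
rewrite !piE; apply/eqmodP; rewrite /= FracField.equivfE /FracField.mulf.
by rewrite !numden_Ratio ?mulf_neq0 ?oner_eq0 ?denom_ratioP // !mulr1 mulrC.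
Qed.

Lemma ratfun_t_neq0 : ratfun_t != 0.
Proof. by rewrite tofrac_eq0 polyX_eq0. Qed.

Lemma loc0_denom (x : ratfun k) :
  exists mv : nat * loc0, x * ratfun_t ^+ mv.1 = loc0_val mv.2.
Proof.
have [p [q [q0 ->]]] := ratfunP x.
have [m [r]] := multiplicity_XsubC q 0; rewrite q0 /= subr0 => r0 def_q.
have vP : (p%:F / r%:F : ratfun k) \in loc0_pred by apply/loc0P; exists p, r.
exists (m, Loc0 vP) => /=; rewrite def_q tofracM tofracXn invfM mulrA.
by rewrite mulfVK // expf_neq0 // ratfun_t_neq0.
Qed.
End RationalFunctions.

Section Localization.
Variables (k : fieldType) (R : algType k).
Local Notation V := (loc0 k).
Local Notation K := (ratfun k).
Local Notation RV := (tensalg R V).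
Local Notation RK := (tensalg R K).

Definition tens_t : RV := tens_inr R V (loc0_t k).

Lemma tens_t_pure i (r : R) (v : V) :
  tens_t ^+ i * pure r v = pure r (loc0_t k ^+ i * v) :> RV.
Proof. by rewrite /tens_t -rmorphXn /= [tens_inr _ _ _]/(pure _ _) pureM mul1r. Qed.

Lemma tens_t_comm (a : RV) : tens_t * a = a * tens_t.
Proof.
move: a; apply: tens_lift_ext => [x y|x y|r v]; rewrite ?mulrDr ?mulrDl //.
by rewrite !pureM mul1r mulr1 mulrC.
Qed.

Variable Q : lmodType RV.

Definition tsub_pred : pred Q := fun q => `[< exists q', q = tens_t *: q' >].

Lemma tsub_predP q : reflect (exists q', q = tens_t *: q') (q \in tsub_pred).
Proof. exact: asboolP. Qed.

Fact tsub_submod : subsemimod_closed tsub_pred.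
Proof.
split; first split.
- by apply/tsub_predP; exists 0; rewrite scaler0.
- move=> x y /tsub_predP[x' ->] /tsub_predP[y' ->]; apply/tsub_predP.
  by exists (x' + y'); rewrite scalerDr.
- move=> a x /tsub_predP[x' ->]; apply/tsub_predP; exists (a *: x').
  by rewrite !scalerA tens_t_comm.
Qed.

(* The submodule [t Q]. *)
Definition tsub : submodClosed Q :=
  HB.pack tsub_pred (GRing.isSubSemiModClosed.Build RV Q tsub_pred tsub_submod).

(* The fraction [q / t ^ n] is represented by the pair [(q, n)]. *)
Definition tloc_eq (x y : Q * nat) : bool :=
  `[< exists m, tens_t ^+ (m + y.2) *: x.1 = tens_t ^+ (m + x.2) *: y.1 >].

Lemma tpow i j (q : Q) :
  tens_t ^+ i *: (tens_t ^+ j *: q) = tens_t ^+ (i + j) *: q.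
Proof. by rewrite scalerA exprD. Qed.

Fact tloc_eq_equiv : equiv_class_of tloc_eq.
Proof.
split=> [x|x y|y x z].
- by apply/asboolP; exists 0%N.
- by apply/idP/idP => /asboolP[m h]; apply/asboolP; exists m.
- move=> /asboolP[m h1] /asboolP[l h2]; apply/asboolP.
  exists (m + l + y.2)%N.
  have -> : (m + l + y.2 + z.2 = (l + z.2) + (m + y.2))%N by lia.
  have -> : (m + l + y.2 + x.2 = (m + x.2) + (l + y.2))%N by lia.
  by rewrite -(tpow (l + z.2)) h1 -(tpow (m + x.2)) -h2 !tpow addnC.
Qed.
Canonical tloc_eq_equivRel := EquivRelPack tloc_eq_equiv.
Canonical tloc_eq_encModRel := defaultEncModRel tloc_eq.

Definition tloc : Type := {eq_quot tloc_eq}.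
HB.instance Definition _ := Choice.on tloc.
HB.instance Definition _ : EqQuotient _ tloc_eq tloc := EqQuotient.on tloc.

Definition tfrac (q : Q) (n : nat) : tloc := \pi_tloc (q, n).

Lemma tfracP q n q' n' : tfrac q n = tfrac q' n' <->
  exists m, tens_t ^+ (m + n') *: q = tens_t ^+ (m + n) *: q'.
Proof.
split=> [/eqmodP /asboolP //|h]; apply/eqmodP; exact/asboolP.
Qed.

Lemma tloc_ind (P : tloc -> Prop) : (forall q n, P (tfrac q n)) -> forall x, P x.
Proof. by move=> h x; rewrite -[x]reprK; case: (repr x) => q n; apply: h. Qed.

Lemma tfrac_shift i q n : tfrac q n = tfrac (tens_t ^+ i *: q) (n + i).
Proof. by apply/tfracP; exists 0%N; rewrite tpow. Qed.

Definition tloc_add (x y : tloc) : tloc :=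
  tfrac (tens_t ^+ (repr y).2 *: (repr x).1 + tens_t ^+ (repr x).2 *: (repr y).1)
        ((repr x).2 + (repr y).2).

Definition tloc_opp (x : tloc) : tloc := tfrac (- (repr x).1) (repr x).2.

Lemma repr_tfrac q n : exists m,
  tens_t ^+ (m + n) *: (repr (tfrac q n)).1
    = tens_t ^+ (m + (repr (tfrac q n)).2) *: q.
Proof. by apply/tfracP; rewrite /tfrac -surjective_pairing reprK. Qed.

Lemma tloc_addE q n q' n' : tloc_add (tfrac q n) (tfrac q' n') =
  tfrac (tens_t ^+ n' *: q + tens_t ^+ n *: q') (n + n').
Proof.
rewrite /tloc_add; apply/tfracP.
have [m h] := repr_tfrac q n; have [l h'] := repr_tfrac q' n'.
move: (repr _) (repr _) h h' => [s j] [r i] /= h h'.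
exists (m + l)%N; rewrite !scalerDr !tpow; congr (_ + _).
- have -> : (m + l + (n + n') + j = (l + n' + j) + (m + n))%N by lia.
  by rewrite -tpow h tpow; congr (_ ^+ _ *: _); lia.
- have -> : (m + l + (n + n') + i = (m + n + i) + (l + n'))%N by lia.
  by rewrite -tpow h' tpow; congr (_ ^+ _ *: _); lia.
Qed.

Lemma tloc_add_same q q' n :
  tloc_add (tfrac q n) (tfrac q' n) = tfrac (q + q') n.
Proof. by rewrite tloc_addE -scalerDr -tfrac_shift. Qed.

Lemma tloc_oppE q n : tloc_opp (tfrac q n) = tfrac (- q) n.
Proof.
rewrite /tloc_opp; apply/tfracP; have [m h] := repr_tfrac q n.
by exists m; rewrite !scalerN h.
Qed.

(* Reduction to a common denominator. *)
Lemma tloc_ind2 (P : tloc -> tloc -> Prop) :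
  (forall q q' n, P (tfrac q n) (tfrac q' n)) -> forall x y, P x y.
Proof.
move=> h; elim/tloc_ind=> q n; elim/tloc_ind=> q' n'.
by rewrite (tfrac_shift n' q) (tfrac_shift n q') [(n' + n)%N]addnC.
Qed.

Fact tloc_addC : commutative tloc_add.
Proof. by refine (tloc_ind2 _) => q q' n; rewrite !tloc_add_same addrC. Qed.
Fact tloc_addA : associative tloc_add.
Proof.
refine (tloc_ind2 _) => q q' n; elim/tloc_ind=> q'' n''.
rewrite (tfrac_shift n'' q) (tfrac_shift n'' q') (tfrac_shift n q'').
by rewrite [(n'' + n)%N]addnC !tloc_add_same addrA.
Qed.
Fact tloc_add0 : left_id (tfrac 0 0) tloc_add.
Proof. by elim/tloc_ind=> q n; rewrite tloc_addE scaler0 add0r expr0 scale1r. Qed.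
Fact tloc_addN : left_inverse (tfrac 0 0) tloc_opp tloc_add.
Proof.
elim/tloc_ind=> q n; rewrite tloc_oppE tloc_add_same addNr.
by rewrite (tfrac_shift n 0 0) scaler0.
Qed.
HB.instance Definition _ := GRing.isZmodule.Build tloc
  tloc_addA tloc_addC tloc_add0 tloc_addN.

Lemma tfracD q q' n : tfrac q n + tfrac q' n = tfrac (q + q') n.
Proof. exact: tloc_add_same. Qed.

Lemma tpow_pure m a r (v : V) (q : Q) :
  tens_t ^+ (m + a) *: ((pure r v : RV) *: q)
    = (pure r (loc0_t k ^+ m * v) : RV) *: (tens_t ^+ a *: q).
Proof.
have tC (b : RV) : tens_t ^+ a * b = b * tens_t ^+ a.
  by apply/esym/commrX; rewrite /GRing.comm tens_t_comm.
by rewrite !scalerA addnC exprD -mulrA tens_t_pure tC.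
Qed.

(* [r (x) x] acts on [q / t ^ n] as [(r (x) x t ^ m) q / t ^ (m + n)], for any
   [m] such that [x t ^ m] lies in [V]. *)
Definition tloc_act (r : R) (x : K) (z : tloc) : tloc :=
  let mv := sval (cid (loc0_denom x)) in
  tfrac ((pure r mv.2 : RV) *: (repr z).1) (mv.1 + (repr z).2).

Lemma tloc_actE r x m (v : V) q n : x * ratfun_t k ^+ m = loc0_val v ->
  tloc_act r x (tfrac q n) = tfrac ((pure r v : RV) *: q) (m + n).
Proof.
move=> xm; rewrite /tloc_act; case: cid => -[l w] /= xl.
have [i h] := repr_tfrac q n; move: (repr _) h => [s j] /= h.
apply/tfracP; exists i.
have vw : loc0_t k ^+ m * w = loc0_t k ^+ l * v.
  apply: loc0_val_inj; rewrite !loc0_valM !loc0_valX /= -xl -xm.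
  rewrite mulrCA [RHS]mulrCA. by rewrite [X in _ * X]mulrC.
have -> : (i + (m + n) = m + (i + n))%N by lia.
have -> : (i + (l + j) = l + (i + j))%N by lia.
by rewrite !tpow_pure vw h.
Qed.

Lemma tloc_den1 (x : K) : exists m (v : V), x * ratfun_t k ^+ m = loc0_val v.
Proof. by have [[m v] h] := loc0_denom x; exists m, v. Qed.

Lemma tden_shift i (x : K) m (v : V) : x * ratfun_t k ^+ m = loc0_val v ->
  x * ratfun_t k ^+ (m + i) = loc0_val (loc0_t k ^+ i * v).
Proof. by move=> h; rewrite loc0_valM loc0_valX /= -h exprD mulrA mulrC. Qed.

Lemma tloc_den2 (x y : K) : exists m (v w : V),
  x * ratfun_t k ^+ m = loc0_val v /\ y * ratfun_t k ^+ m = loc0_val w.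
Proof.
have [m [v h]] := tloc_den1 x; have [l [w h']] := tloc_den1 y.
exists (m + l)%N; eexists; eexists; split; first exact: tden_shift h.
by rewrite addnC; exact: tden_shift h'.
Qed.

Fact tloc_actD r x : {morph tloc_act r x : y z / y + z}.
Proof.
have [m [v h]] := tloc_den1 x; refine (tloc_ind2 _) => q q' n.
by rewrite tfracD !(tloc_actE _ _ _ h) tfracD scalerDr.
Qed.

Fact tloc_act_bal z : balanced (fun (r : R) (x : K) => tloc_act r x z).
Proof.
have [bl br bs] := pure_balanced R V.
elim/tloc_ind: z => q n; split=> [x r s|r x y|c r x].
- have [m [v h]] := tloc_den1 x.
  by rewrite !(tloc_actE _ _ _ h) tfracD bl scalerDl.
- have [m [v [w [h h']]]] := tloc_den2 x y.
  have hD : (x + y) * ratfun_t k ^+ m = loc0_val (v + w).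
    by rewrite mulrDl h h' loc0_valD.
  rewrite (tloc_actE _ _ _ h) (tloc_actE _ _ _ h') (tloc_actE _ _ _ hD).
  by rewrite tfracD br scalerDl.
- have [m [v h]] := tloc_den1 x.
  have hZ : (c *: x) * ratfun_t k ^+ m = loc0_val (c *: v).
    by rewrite -scalerAl h loc0_valZ.
  by rewrite (tloc_actE _ _ _ h) (tloc_actE _ _ _ hZ) bs.
Qed.

Fact tloc_act1 z : tloc_act 1 1 z = z.
Proof.
elim/tloc_ind: z => q n.
by rewrite (@tloc_actE _ _ 0 1) ?scale1r // expr0 mulr1 loc0_val1.
Qed.

Fact tloc_actM a b c d z :
  tloc_act (a * c) (b * d) z = tloc_act a b (tloc_act c d z).
Proof.
have [m [v h]] := tloc_den1 b; have [l [w h']] := tloc_den1 d.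
elim/tloc_ind: z => q n.
have hM : (b * d) * ratfun_t k ^+ (m + l) = loc0_val (v * w).
  by rewrite exprD mulrACA h h' loc0_valM.
rewrite (tloc_actE _ _ _ h') (tloc_actE _ _ _ h) (tloc_actE _ _ _ hM).
by rewrite scalerA pureM addnA.
Qed.

HB.instance Definition _ := GRing.Zmodule_isLmodule.Build RK tloc
  (tens_actA tloc_act_bal tloc_actD tloc_actM)
  (tens_act1 tloc_act_bal tloc_act1)
  (tens_actDr tloc_actD) (tens_actDl tloc_act_bal).

Lemma tloc_scaleE r (x : K) m (v : V) q n : x * ratfun_t k ^+ m = loc0_val v ->
  (pure r x : RK) *: tfrac q n = tfrac ((pure r v : RV) *: q) (m + n).
Proof.
by move=> h; rewrite -(tloc_actE _ _ _ h) -(tens_act_pure tloc_act_bal).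
Qed.

End Localization.

Definition degenerates (k : fieldType) (R : algType k) (M N : lmodType R) : Prop :=
  exists Q : lmodType (tensalg R (loc0 k)),
    [/\ fin_gen Q,
        flat (restr (tens_inr R (loc0 k)) Q),
        mod_iso (restr (tens_inl R (loc0 k)) (quotmod (tsub Q))) N
      & mod_iso (tloc Q) (tensmod M (ratfun k)^o)].

Section IsoClasses.
Variables (k : fieldType) (R : algType k).

(* Universe constraints forbid a [choiceType] of modules of type [lmodType R];
   the isomorphism classes are taken on the quotients of the free modules of
   finite rank instead, see [iso_classP]. *)
Record fgpres : Type :=
  FgPres { fg_rank : nat; fg_rel : submodClosed 'rV[R]_fg_rank }.
HB.instance Definition _ := gen_eqMixin fgpres.
HB.instance Definition _ := gen_choiceMixin fgpres.

Definition fg_mod (P : fgpres) : lmodType R := quotmod (fg_rel P).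

Definition fg_iso (P P' : fgpres) : bool := `[< mod_iso (fg_mod P) (fg_mod P') >].

Fact fg_iso_equiv : equiv_class_of fg_iso.
Proof.
split=> [P|P P'|P' P P''].
- exact/asboolP/mod_iso_refl.
- by apply/idP/idP => /asboolP /mod_iso_sym /asboolP.
- by move=> /asboolP h /asboolP h'; apply/asboolP/(mod_iso_trans h).
Qed.
Canonical fg_iso_equivRel := EquivRelPack fg_iso_equiv.
Canonical fg_iso_encModRel := defaultEncModRel fg_iso.

(* The set [mod(R)]. *)
Definition iso_class : Type := {eq_quot fg_iso}.
HB.instance Definition _ := Choice.on iso_class.
HB.instance Definition _ : EqQuotient _ fg_iso iso_class :=
  EqQuotient.on iso_class.

Definition class_mod (x : iso_class) : lmodType R := fg_mod (repr x).

Lemma class_mod_fin_gen x : fin_gen (class_mod x).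
Proof.
rewrite /class_mod /fg_mod; case: (repr x) => n N /=.
exists n, (fun i => \pi_(quotmod N) (delta_mx 0 i)); elim/quotW => v.
exists (fun i => v 0 i); rewrite {1}[v]row_sum_delta.
have pi0 : \pi_(quotmod N) 0 = 0 by rewrite !piE.
rewrite (big_morph _ (@quotmodD _ _ N) pi0).
by apply: eq_bigr => i _; rewrite quotmodZ.
Qed.

Lemma iso_class_inj x y : mod_iso (class_mod x) (class_mod y) -> x = y.
Proof. by move=> h; rewrite -[x]reprK -[y]reprK; apply/eqmodP/asboolP. Qed.

Lemma iso_classP (M : lmodType R) :
  fin_gen M -> exists! x, mod_iso (class_mod x) M.
Proof.
case=> n [x gen_x].
pose f (v : 'rV[R]_n) : M := \sum_i v 0 i *: x i.
have fL : linear f.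
  move=> a u v; rewrite /f scaler_sumr -big_split; apply: eq_bigr => i _ /=.
  by rewrite !mxE scalerDl scalerA.
pose F : {linear 'rV[R]_n -> M} :=
  HB.pack f (GRing.isLinear.Build R _ M *:%R f fL).
pose N : pred 'rV[R]_n := fun v => f v == 0.
have Nsub : subsemimod_closed N.
  split; first split; rewrite ?inE.
  - by apply/eqP; apply: (linear0 F).
  - move=> u v /eqP fu /eqP fv; apply/eqP.
    by rewrite -[f _]/(F (u + v)) linearD /= fu fv addr0.
  - move=> a v /eqP fv; apply/eqP.
    by rewrite -[f _]/(F (a *: v)) linearZ /= fv scaler0.
pose N' : submodClosed 'rV[R]_n :=
  HB.pack N (GRing.isSubSemiModClosed.Build R _ N Nsub).
pose g (u : quotmod N') : M := f (repr u).
have gE v : g (\pi_(quotmod N') v) = f v.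
  apply/eqP; rewrite -subr_eq0 -[f v]/(F v) -[g _]/(F (repr _)) -linearB.
  by rewrite -[_ == 0]/(_ \in N'); apply/quotmodP; rewrite reprK.
have gL : linear g.
  move=> a; elim/quotW => u; elim/quotW => v.
  by rewrite -quotmodZ -quotmodD !gE fL.
pose G : {linear quotmod N' -> M} :=
  HB.pack g (GRing.isLinear.Build R _ M *:%R g gL).
have g_inj : injective g.
  elim/quotW => u; elim/quotW => v; rewrite !gE => fuv; apply/quotmodP.
  apply/eqP; rewrite -[f _]/(F (u - v)) linearB /=.
  by apply/eqP; rewrite subr_eq0 fuv.
have g_surj y : exists u, g u = y.
  have [c ->] := gen_x y; exists (\pi_(quotmod N') (\row_i c i)).
  by rewrite gE; apply: eq_bigr => i _; rewrite mxE.
have isoM : mod_iso (quotmod N') M.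
  exists G; exists (fun y => sval (cid (g_surj y))) => [u|y].
    by apply: g_inj; case: cid.
  by case: cid.
exists (\pi_iso_class (FgPres N')).
have isoP : mod_iso (class_mod (\pi_iso_class (FgPres N'))) M.
  apply: mod_iso_trans isoM; apply: mod_iso_sym.
  suff /asboolP : fg_iso (FgPres N') (repr (\pi_iso_class (FgPres N'))) by [].
  by apply/eqmodP; rewrite reprK.
split=> // y /mod_iso_sym isoy; apply: iso_class_inj.
exact: mod_iso_trans isoP isoy.
Qed.

(* The operator [K(-)]; [{ffun 'I_n -> M}] is the direct sum of [n] copies
   of [M]. *)
Definition kuratowski (X : set iso_class) : set iso_class :=
  [set y | exists2 x, X x & exists2 n, (0 < n)%N &
     degenerates ({ffun 'I_n -> class_mod x} : lmodType R)
                 ({ffun 'I_n -> class_mod y} : lmodType R)].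

End IsoClasses.

Section LocalAlgebra.
Variable R : nzRingType.

(* Ideals are the submodules of [R^o]; all rings below are commutative. *)
Definition noetherian : Prop :=
  forall I : submodClosed R^o, exists s : seq R,
    I =i span (M := R^o) [set x | x \in s].

Definition maximal_ideal (m : idealr R) : Prop :=
  forall J : idealr R, {subset m <= J} -> J =i m.

Definition prime_chain (l : nat) (P : nat -> prime_idealr R) : Prop :=
  forall i, (i < l)%N ->
    {subset P i <= P i.+1} /\ ~ {subset P i.+1 <= P i}.

Definition krull_dim (n : nat) : Prop :=
  (exists P, prime_chain n P) /\ (forall l P, prime_chain l P -> (l <= n)%N).

Definition submod_chain (M : lmodType R) (l : nat)
    (N : nat -> submodClosed M) : Prop :=
  forall i, (i < l)%N ->
    {subset N i <= N i.+1} /\ ~ {subset N i.+1 <= N i}.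

Definition mod_length (M : lmodType R) (n : nat) : Prop :=
  (exists N : nat -> submodClosed M, submod_chain n N) /\
  (forall l (N : nat -> submodClosed M), submod_chain l N -> (l <= n)%N).

Variable M : lmodType R.

(* The submodule [I N]. *)
Definition smul (I : {pred R}) (N : {pred M}) : submodClosed M :=
  span [set z | exists2 a, a \in I & exists2 y, y \in N & z = a *: y].

Definition regular_on (L : lmodType R) (a : R) : Prop :=
  forall y : L, a *: y = 0 -> y = 0.

Definition regular_seq (s : seq R) : Prop :=
  (forall i, (i < size s)%N ->
     regular_on (quotmod (smul (mem (take i s)) predT)) s`_i) /\
  (exists y, y \notin smul (mem s) predT).

Variable m : idealr R.

Definition depth (n : nat) : Prop :=
  (exists s, [/\ size s = n, {subset s <= m} & regular_seq s]) /\
  (forall s, {subset s <= m} -> regular_seq s -> (size s <= n)%N).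

Fixpoint adic (i : nat) : submodClosed M :=
  if i is i'.+1 then smul m (adic i') else span setT.

Definition maximal_CM : Prop :=
  fin_gen M /\ exists2 n, krull_dim n & depth n.

(* [e(m, M)] taken with respect to [dim R]; it agrees with the one taken with
   respect to [dim M] when [M] is maximal Cohen-Macaulay. *)
Definition multiplicity (e : nat) : Prop :=
  exists r (ell : nat -> nat),
    [/\ krull_dim r,
        forall n, mod_length (quotmod (adic n)) (ell n)
      & ((fun n => (r`! * ell n)%:R / n%:R ^+ r : rat^o) @ \oo --> (e%:R : rat^o))%classic].

End LocalAlgebra.

Definition CM_local (R : nzRingType) (m : idealr R) : Prop :=
  [/\ commutative (@GRing.mul R),
      noetherian R,
      maximal_ideal m,
      (forall m' : idealr R, maximal_ideal m' -> m' =i m)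
    & exists2 n, krull_dim R n & depth R^o m n].

Definition coefficient_field (k : fieldType) (R : algType k) (m : idealr R)
  : Prop := bijective (fun c : k => \pi_(Quotient.quot m) c%:A).

(* The set [E(d)]. *)
Definition MCM_classes (k : fieldType) (R : algType k) (m : idealr R) (d : nat)
  : set (iso_class R) :=
  [set x | maximal_CM (class_mod x) m /\ multiplicity (class_mod x) m d].

Definition topology (T : Type) : Type := Topological.axioms_ T.
Definition tspace (T : Type) (tau : topology T) : topologicalType :=
  Topological.Pack tau.

(* Main.v *)
Require Import Defs.
From HB Require Import structures.
From mathcomp Require Import all_boot all_algebra.
From mathcomp Require Import all_classical topology.
From mathcomp Require Import zify.

Set Implicit Arguments.
Unset Strict Implicit.
Unset Printing Implicit Defensive.

Import GRing.Theory.
Local Open Scope ring_scope.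
Local Open Scope quotient_scope.

(** Everything except the idempotence of [kuratowski] is formal, and the content
    of idempotence is that degeneration is transitive.  That is proved by
    trading modules over [R (x) V] for lattices in power series.

    If [Q] realises a degeneration of [M] to [N], then, after scaling by a power
    of [t], it lies between [t^m (M (x) V)] and [M (x) V].  Such a lattice is
    determined by what it is modulo a power of [t], so it can be recorded as an
    [R]-submodule [P] of [M[[t]]] stable under [t] and containing all series of
    order at least [m], together with an isomorphism of [P / tP] with [N].
    [lattice_degenerates] is this notion, and [degeneratesP] says that it agrees
    with [degenerates] on finitely generated modules.

    For lattices transitivity is a change of variable.  Let [P] in [L[[t]]] have
    fibre [M], and let [P'] in [M[[s]]] have fibre [N] and contain the series of
    order at least [m'].  Put [t = s^e] with [e = m' + 1].  A series in [s] over
    [L] is a family of [e] series [f_0, .., f_(e-1)] in [t]; those with every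
    [f_i] in [P] form the extension of [P] to [s], which modulo [s^e] becomes
    [M[[s]] / s^e M[[s]]].  The inverse image of [P'] is a lattice
    in [L[[s]]], and its fibre is that of [P'] because [s^e M[[s]]] is contained
    in [s P'] ([lattice_degenerates_trans]).  Direct sums of lattices are
    lattices, so a degeneration of [M^a] gives one of [M^(ab)], which lets two
    exponents be combined.

    Passing between the two notions uses the Taylor expansion of elements of
    [M (x) V] and one fact on flatness: a module [Q] over [V] is flat iff [t] is
    injective on it.  That torsion-freeness suffices ([torsion_free_flat]) is
    proved by duality.  For every abelian group [W] the [V]-module of additive
    maps from [Q] to [W] is divisible, because [t] has a [k]-linear retraction
    on [Q]; hence it is injective by Baer's criterion, and by the tensor-hom
    adjunction the functor [Q (x) -] preserves injections. *)

(** * Degenerations as lattices of power series *)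

Lemma mod_iso_intro (A : pzRingType) (M N : lmodType A) (f : M -> N) :
  linear f -> injective f -> (forall y, exists x, f x = y) -> mod_iso M N.
Proof.
move=> fL f_inj f_surj.
pose F : {linear M -> N} := HB.pack f (GRing.isLinear.Build A M N *:%R f fL).
have [g gK] := choice f_surj.
by exists F; exists g => // x; apply: f_inj; rewrite gK.
Qed.

Section LatticeDegenerations.
Variable R : pzRingType.
Implicit Types M N L : lmodType R.

(** Multiplication by [t] on the series [f 0 + f 1 t + ...]. *)
Definition tshift M (f : nat -> M) : nat -> M :=
  fun i => if i is j.+1 then f j else 0.

(** The relation [D f x] is the graph of a surjection [P -> N] with kernel
    [tP], where the lattice [P] is the domain of [D]: the series [f] is in
    [P] and its image in [P / tP = N] is [x]. Working with the graph
    avoids forming [P] as a module. *)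
Record lattice_graph M N (m : nat) (D : (nat -> M) -> N -> Prop) : Prop :=
  LatticeGraph {
    lattice_linear : forall a f g x y, D f x -> D g y ->
      D (fun i => a *: f i + g i) (a *: x + y);
    lattice_functional : forall x, D (fun=> 0) x -> x = 0;
    lattice_surj : forall x, exists f, D f x;
    lattice_shift : forall f x, D f x -> D (tshift f) 0;
    lattice_ker : forall f, D f 0 -> exists g x, f = tshift g /\ D g x;
    lattice_tail : forall f, (forall i, (i < m)%N -> f i = 0) ->
      exists x, D f x }.

Definition lattice_degenerates M N : Prop := exists m D, @lattice_graph M N m D.

Section Theory.
Variables (M N : lmodType R) (m : nat) (D : (nat -> M) -> N -> Prop).
Hypothesis DL : lattice_graph m D.

Lemma lattice_graphB f g x y : D f x -> D g y -> D (fun i => f i - g i) (x - y).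
Proof.
move=> Df Dg; have := lattice_linear DL (-1) Dg Df; rewrite scaleN1r addrC.
by congr D; apply: funext => i; rewrite scaleN1r addrC.
Qed.

Lemma lattice_graph0 : D (fun=> 0) 0.
Proof.
have [f Df] := lattice_surj DL 0; have := lattice_graphB Df Df.
by rewrite subrr; congr D; apply: funext => i; rewrite subrr.
Qed.

Lemma lattice_graphD f g x y : D f x -> D g y -> D (fun i => f i + g i) (x + y).
Proof.
move=> Df Dg; have := lattice_linear DL 1 Df Dg; rewrite scale1r.
by congr D; apply: funext => i; rewrite scale1r.
Qed.

Lemma lattice_graphZ a f x : D f x -> D (fun i => a *: f i) (a *: x).
Proof.
move=> Df; have := lattice_linear DL a Df lattice_graph0; rewrite addr0.
by congr D; apply: funext => i; rewrite addr0.
Qed.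

Lemma lattice_graph_uniq f x y : D f x -> D f y -> x = y.
Proof.
move=> Df Dg; apply/eqP; rewrite -subr_eq0; apply/eqP.
apply: (lattice_functional DL); have := lattice_graphB Df Dg.
by congr D; apply: funext => i; rewrite subrr.
Qed.

(** The bound is one more than in [lattice_tail]: dividing by [t] leaves a
    series that is still in the lattice, so the original one dies in the
    fibre. *)
Lemma lattice_graph_tail0 f : (forall i, (i <= m)%N -> f i = 0) -> D f 0.
Proof.
move=> f0; have [|x Dx] := lattice_tail DL (f := fun i => f i.+1).
  by move=> i im; apply: f0.
have := lattice_shift DL Dx; congr D; apply: funext => -[|i] //=.
by rewrite f0.
Qed.

(** Both membership in the lattice and the image in the fibre depend only on
    the series modulo [t^(m+1)]. *)
Lemma lattice_graph_congr f g x :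
  (forall i, (i <= m)%N -> f i = g i) -> D f x -> D g x.
Proof.
move=> fg Df; have /lattice_graphD/(_ Df) : D (fun i => g i - f i) 0.
  by apply: lattice_graph_tail0 => i im; rewrite fg // subrr.
by rewrite add0r; congr D; apply: funext => i; rewrite subrK.
Qed.

End Theory.

(** The lattice is all of [M[[t]]], and the fibre map is the constant term. *)
Lemma lattice_degenerates_refl M : lattice_degenerates M M.
Proof.
exists 0%N, (fun f x => f 0%N = x); split=> //.
- by move=> a f g x y -> ->.
- by move=> x; exists (fun=> x).
- move=> f f0; exists (fun i => f i.+1), (f 1%N); split=> //.
  by apply: funext => -[|i].
- by move=> f f0; exists (f 0%N).
Qed.

(** A series [f] in [s] over [L] is cut along [t = s^e] into the [e] series
    [part i f] in [t]. It belongs to the new lattice when each part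
    belongs to the lattice in [L[[t]]] and the classes [mu i] of the parts
    are the first [e] coefficients of a series [mu] of the lattice in
    [M[[s]]]. The coefficients of [mu] from [e] on may be arbitrary, since
    changing them changes [mu] by an element of [s^e M[[s]]], which is
    zero in the fibre. *)
Lemma lattice_degenerates_trans L M N :
  lattice_degenerates L M -> lattice_degenerates M N -> lattice_degenerates L N.
Proof.
move=> [m1 [D1 L1]] [m2 [D2 L2]].
pose e := m2.+1.
pose part (i : nat) (f : nat -> L) : nat -> L := fun k => f (e * k + i)%N.
pose D f x := exists mu : nat -> M,
  (forall i, (i < e)%N -> D1 (part i f) (mu i)) /\ D2 mu x.
exists (e * m1.+1)%N, D; split.
- move=> a f g x y [mu [fmu mux]] [nu [gnu nuy]].
  exists (fun i => a *: mu i + nu i); split; last exact: (lattice_linear L2).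
  by move=> i ie; apply: (lattice_linear L1 a (fmu i ie) (gnu i ie)).
- move=> x [mu [mu0 mux]].
  have {}mu0 i : (i < e)%N -> mu i = 0.
    by move=> ie; apply: (lattice_functional L1); apply: mu0.
  by apply: (lattice_graph_uniq L2 mux); apply: (lattice_graph_tail0 L2).
- move=> x; have [mu Dmu] := lattice_surj L2 x.
  have [F DF] := choice (fun i => lattice_surj L1 (mu i)).
  exists (fun j => F (j %% e)%N (j %/ e)%N), mu; split=> // i ie.
  rewrite -[part i _]/(fun k => _); have := DF i; congr D1.
  apply: funext => k; rewrite mulnC modnMDl modn_small //.
  by rewrite divnMDl // divn_small // addn0.
- move=> f x [mu [fmu mux]]; exists (tshift mu); split; last first.
    exact: (lattice_shift L2 mux).
  move=> [|i] ie.
    have := lattice_shift L1 (fmu m2 (ltnSn _)); congr D1.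
    apply: funext => -[|k]; rewrite /part addn0; first by rewrite muln0.
    by have -> : (e * k.+1 = (e * k + m2).+1)%N by rewrite /e; lia.
  have := fmu i (ltnW ie); congr D1; apply: funext => k.
  by rewrite /part addnS.
- move=> f [mu [fmu /(lattice_ker L2)[nu [x [Emu nux]]]]].
  have : D1 (part 0%N f) 0 by have := fmu 0%N (ltn0Sn _); rewrite Emu.
  move=> /(lattice_ker L1)[h [y [Eh hy]]].
  pose nu' i := if i == m2 then y else nu i.
  (* The class [mu 0] vanishes, so [part 0 f] is [t h]. Dividing [f] by [s]
     moves [h] to the last place [m2]; correcting [nu] there does not leave the
     lattice. *)
  have [x' Dx'] : exists x', D2 nu' x'.
    have [|z Dz] := lattice_tail L2 (f := fun i => nu' i - nu i).
      by move=> i im; rewrite /nu' ltn_eqF // subrr.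
    have := lattice_graphD L2 Dz nux => Dn; eexists.
    have -> : nu' = (fun i => nu' i - nu i + nu i).
      by apply: funext => i; rewrite subrK.
    exact: Dn.
  have f0 : f 0%N = 0.
    by have := congr1 (fun g => g 0%N) Eh; rewrite /part /= muln0.
  exists (fun i => f i.+1), x'; split; first by apply: funext => -[].
  exists nu'; split=> // i ie; rewrite /nu'; case: eqP => [->|im].
    have := hy; congr D1; apply: funext => k.
    have := congr1 (fun g => g k.+1) Eh; rewrite /part /= => <-.
    by congr f; rewrite /e; lia.
  have ie' : (i.+1 < e)%N by rewrite /e in ie *; lia.
  have := fmu _ ie'; rewrite Emu /=; congr D1; apply: funext => k.
  by rewrite /part addnS.
- move=> f f0; exists 0; exists (fun=> 0).
  split; last exact: (lattice_graph0 L2).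
  move=> i ie; apply: (lattice_graph_tail0 L1) => k km.
  apply: f0; rewrite /e in ie *; nia.
Qed.

Lemma lattice_degenerates_ffun n M N : lattice_degenerates M N ->
  lattice_degenerates ({ffun 'I_n -> M} : lmodType R)
                      ({ffun 'I_n -> N} : lmodType R).
Proof.
move=> [m [D DL]].
exists m, (fun (f : nat -> {ffun 'I_n -> M}) (x : {ffun 'I_n -> N}) =>
  forall i, D (fun j => f j i) (x i)); split.
- move=> a f g x y Df Dg i; rewrite !ffunE.
  have := lattice_linear DL a (Df i) (Dg i); congr D.
  by apply: funext => j; rewrite !ffunE.
- move=> x Dx; apply/ffunP => i; rewrite ffunE.
  apply: (lattice_functional DL); have := Dx i; congr D.
  by apply: funext => j; rewrite ffunE.
- move=> x; have [F DF] := choice (fun i => lattice_surj DL (x i)).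
  exists (fun j => [ffun i => F i j]) => i; have := DF i; congr D.
  by apply: funext => j; rewrite ffunE.
- move=> f x Df i; rewrite ffunE; have := lattice_shift DL (Df i); congr D.
  by apply: funext => -[|j] //=; rewrite ffunE.
- move=> f Df.
  have ker i : exists gx : (nat -> M) * N,
      (fun j => f j i) = tshift gx.1 /\ D gx.1 gx.2.
    have /(lattice_ker DL)[g [x h]] : D (fun j => f j i) 0.
      by have := Df i; rewrite ffunE.
    by exists (g, x).
  have [G DG] := choice ker.
  exists (fun j => [ffun i => (G i).1 j]), [ffun i => (G i).2]; split.
    apply: funext => j; apply/ffunP => i; have [h _] := DG i.
    by rewrite (congr1 (@^~ j) h); case: j => [|j] /=; rewrite ffunE.
  move=> i; have [_] := DG i; rewrite ffunE; congr D.
  by apply: funext => j; rewrite ffunE.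
- move=> f f0.
  have tlift i : exists x, D (fun j => f j i) x.
    by apply: (lattice_tail DL) => j jm; rewrite f0 // ffunE.
  have [x Dx] := choice tlift; exists (finfun x) => i; rewrite ffunE; exact: Dx.
Qed.

Lemma lattice_degenerates_iso M M' N N' : mod_iso M M' -> mod_iso N N' ->
  lattice_degenerates M N -> lattice_degenerates M' N'.
Proof.
move=> [u [u' uK u'K]] [v [v' vK v'K]] [m [D DL]].
have u'0 : u' 0 = 0 by rewrite -[in LHS](linear0 u) uK.
exists m, (fun f x => exists g y, [/\ f = u \o g, x = v y & D g y]); split.
- move=> a _ _ _ _ [f [x [-> -> Df]]] [g [y [-> -> Dg]]].
  exists (fun i => a *: f i + g i), (a *: x + y); split.
  + by apply: funext => i /=; rewrite linearP.
  + by rewrite linearP.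
  + exact: (lattice_linear DL).
- move=> _ [g [y [g0 -> Dg]]].
  suff -> : y = 0 by rewrite linear0.
  apply: (lattice_functional DL); have := Dg; congr D; apply: funext => i.
  have ug : u (g i) = 0 := esym (congr1 (@^~ i) g0).
  by rewrite -[g i]uK ug.
- move=> x; have [f Df] := lattice_surj DL (v' x).
  by exists (u \o f), f, (v' x); rewrite v'K.
- move=> _ _ [f [x [-> _ Df]]]; exists (tshift f), 0; rewrite linear0.
  split=> //; last exact: (lattice_shift DL Df).
  by apply: funext => -[|i] /=; rewrite ?linear0.
- move=> _ [f [x [-> x0 Df]]].
  have Ex : x = 0 by rewrite -[x]vK -x0 -[in LHS](linear0 v) vK.
  rewrite {}Ex in Df; have [g [y [-> Dg]]] := lattice_ker DL Df.
  exists (u \o g), (v y); split; last by exists g, y.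
  by apply: funext => -[|i] /=; rewrite ?linear0.
- move=> f f0; have [|x Dx] := lattice_tail DL (f := u' \o f).
    by move=> i im /=; rewrite f0.
  exists (v x), (u' \o f), x; split=> //.
  by apply: funext => i /=; rewrite u'K.
Qed.

Lemma ffun_ffun_iso a b M :
  mod_iso ({ffun 'I_b -> {ffun 'I_a -> M}} : lmodType R)
          ({ffun 'I_(a * b) -> M} : lmodType R).
Proof.
pose h : 'I_(a * b) -> 'I_a * 'I_b := fun i =>
  enum_val (cast_ord (esym (mxvec_cast a b)) i).
have [h' hK h'K] : bijective h.
  by exists (fun p => cast_ord (mxvec_cast a b) (enum_rank p)) => i;
    rewrite /h ?cast_ordK ?cast_ordKV ?enum_valK ?enum_rankK ?cast_ordKV.
pose F (f : {ffun 'I_b -> {ffun 'I_a -> M}}) : {ffun 'I_(a * b) -> M} :=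
  [ffun i => f (h i).2 (h i).1].
have FL : linear F by move=> c f g; apply/ffunP => i; rewrite !ffunE.
apply: (mod_iso_intro FL) => [f g fg|g].
  apply/ffunP => j; apply/ffunP => i; have /ffunP/(_ (h' (i, j))) := fg.
  by rewrite !ffunE h'K.
exists ([ffun j => [ffun i => g (h' (i, j))]] : {ffun 'I_b ->
  {ffun 'I_a -> M}}).
by apply/ffunP => i; rewrite !ffunE -surjective_pairing hK.
Qed.

Lemma fin_gen_ffun n M : fin_gen M -> fin_gen ({ffun 'I_n -> M} : lmodType R).
Proof.
move=> [p [x gen_x]].
pose y (i : 'I_n) (j : 'I_p) : {ffun 'I_n -> M} :=
  [ffun k => if k == i then x j else 0].
exists #|{: 'I_n * 'I_p}|, (fun l => y (enum_val l).1 (enum_val l).2) => f.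
have [c Ec] := choice (fun i => gen_x (f i)).
exists (fun l => c (enum_val l).1 (enum_val l).2).
rewrite -(reindex (@enum_val _ {: 'I_n * 'I_p})
  (P := xpredT) (F := fun q => c q.1 q.2 *: y q.1 q.2)) /=; last first.
  exact/onW_bij/enum_val_bij.
rewrite -(pair_big xpredT xpredT (fun i j => c i j *: y i j)) /=.
apply/ffunP => k; rewrite sum_ffunE Ec.
rewrite (bigD1 k) //= [X in _ + X]big1 ?addr0 => [|i ik].
  by rewrite sum_ffunE; apply: eq_bigr => j _; rewrite !ffunE eqxx.
rewrite sum_ffunE big1 // => j _; rewrite !ffunE eq_sym (negPf ik).
by rewrite scaler0.
Qed.

End LatticeDegenerations.

(** * Torsion-free modules over k[t]_(t) are flat *)

Section LinearExtension.
Variable A : pzRingType.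

Definition linear_graph (X I : lmodType A) (G : set (X * I)) : Prop :=
  [/\ G (0, 0),
      forall a x y x' y', G (x, y) -> G (x', y') -> G (a *: x + x', a *: y + y')
    & forall y, G (0, y) -> y = 0].

Lemma linear_graph_eq (X I : lmodType A) (G : set (X * I)) x y y' :
  linear_graph G -> G (x, y) -> G (x, y') -> y = y'.
Proof.
move=> [_ GL G0] Gy Gy'; apply/eqP; rewrite -subr_eq0; apply/eqP/G0.
by have := GL (-1) _ _ _ _ Gy' Gy; rewrite !scaleN1r addNr addrC.
Qed.

(** Baer's criterion: a partial linear map from [A] to [I], given by its
    graph, is the restriction of [a |-> a *: z]. *)
Definition baer_injective (I : lmodType A) : Prop :=
  forall J : set (A^o * I), linear_graph J ->
    exists z : I, forall (a : A) w, J (a, w) -> w = a *: z.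

(** By Zorn's lemma [G] extends to a maximal linear graph. If [x0] were
    outside its domain, the ideal of all [a] with [a *: x0] in the domain
    would carry a partial linear map to [I]; Baer's criterion extends it
    to [A], and hence the graph to [x0]. *)
Lemma linear_extension (X I : lmodType A) (G : set (X * I)) :
  baer_injective I -> linear_graph G ->
  exists h : X -> I, linear h /\ forall x y, G (x, y) -> y = h x.
Proof.
move=> Iinj Glin.
(* The union with [G] makes the empty chain admissible. *)
have [|Z [Zlin Zmax]] := @Zorn_bigcup _ (fun Z =>
  linear_graph (Z `|` G)%classic).
  move=> F FP Ftot; set U := (\bigcup_(_ in F) _)%classic.
  have two p q : (U `|` G)%classic p -> (U `|` G)%classic q ->
      exists H, [/\ linear_graph H, H p, H q & (H `<=` U `|` G)%classic].
    have sub Z : F Z -> (Z `|` G `<=` U `|` G)%classic.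
      by move=> FZ r [Zr|Gr]; [left; exists Z|right].
    move=> [[Z FZ Zp]|Gp] [[Z' FZ' Zq]|Gq].
    - have [ZZ'|Z'Z] := Ftot _ _ FZ FZ'.
        exists (Z' `|` G)%classic; split; [exact: FP| | |exact: sub].
          by left; apply: ZZ'.
        by left.
      exists (Z `|` G)%classic; split; [exact: FP| | |exact: sub].
        by left.
      by left; apply: Z'Z.
    - by exists (Z `|` G)%classic; split; [exact: FP|left|right|exact: sub].
    - by exists (Z' `|` G)%classic; split; [exact: FP|right|left|exact: sub].
    - by exists G; split=> // r Gr; right.
  split.
  - by right; case: Glin.
  - move=> a x y x' y' Up Uq; have [H [[_ HL _] Hp Hq sub]] := two _ _ Up Uq.
    by apply: sub; apply: HL.
  - by move=> y Uy; have [H [[_ _ H0] Hy _ _]] := two _ _ Uy Uy; apply: H0.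
set H := (Z `|` G)%classic in Zlin; have [H0 HL HF] := Zlin.
have tot x0 : exists y, H (x0, y).
  have [//|notH] := pselect (exists y, H (x0, y)).
  have [|z zP] := Iinj [set p | H (p.1 *: x0, p.2)]%classic.
    split=> /= [|a b w b' w' Hb Hb'|w].
    - by rewrite scale0r.
    - by rewrite scalerDl -scalerA; apply: HL.
    - by rewrite scale0r; apply: HF.
  pose B := [set p | exists a x y,
    [/\ H (x, y), p.1 = a *: x0 + x & p.2 = a *: z + y]]%classic.
  have HB : (H `<=` B)%classic.
    by move=> [x y] Hp; exists 0, x, y; rewrite !scale0r !add0r.
  have x0B : B (x0, z) by exists 1, 0, 0; rewrite !scale1r !addr0.
  case: (Zmax B).
    split; first by move=> p Zp; apply: HB; left.
    by move=> BZ; case: notH; exists z; left; apply: BZ.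
  have -> : (B `|` G)%classic = B.
    apply/seteqP; split=> p; last by left.
    by case=> // Gp; apply: HB; right.
  split; first exact: HB.
  - move=> a u v u' v' [b [x [y [Hp /= -> ->]]]] [b' [x' [y' [Hp' /= -> ->]]]].
    exists (a * b + b'), (a *: x + x'), (a *: y + y'); split; first exact: HL.
    + by rewrite /= !scalerDr scalerA !scalerDl addrACA.
    + by rewrite /= !scalerDr scalerA !scalerDl addrACA.
  - move=> v [a [x [y [Hp /= x0x ->]]]].
    have Hax : H (a *: x0, - y).
      have := HL (-1) _ _ _ _ Hp H0; rewrite !addr0 !scaleN1r.
      by congr H; congr pair; apply/esym/eqP; rewrite -addr_eq0 -x0x.
    by rewrite -(zP a _ Hax) addNr.
have [h hP] := choice tot; exists h; split.
  move=> a x y; apply: (linear_graph_eq Zlin (hP _)).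
  exact: HL.
by move=> x y Gp; apply: (linear_graph_eq Zlin _ (hP x)); right.
Qed.

End LinearExtension.

Lemma field_baer_injective (k : fieldType) (I : lmodType k) : baer_injective I.
Proof.
move=> J Jlin; have [_ JL J0] := Jlin.
have [[a [w [Jaw a0]]]|nJ] := pselect (exists a w, J (a, w) /\ a != 0).
  exists (a^-1 *: w) => b v Jbv; apply: (linear_graph_eq Jlin Jbv).
  have := JL (b / a) _ _ _ _ Jaw (let: And3 h _ _ := Jlin in h).
  rewrite !addr0 scalerA; congr J; congr pair.
  by rewrite -[_ *: a]/(_ * a) divfK.
exists 0 => a w Jaw; rewrite scaler0; apply: J0.
have [<- //|a0] := eqVneq a 0.
by case: nJ; exists a, w.
Qed.

(** The inverse of [f] is a partial map on [U'], and it extends to all of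
    [U']. *)
Lemma linear_retraction (k : fieldType) (U U' : lmodType k) (f : U -> U') :
  linear f -> injective f -> exists g : U' -> U, linear g /\ cancel f g.
Proof.
move=> fL f_inj.
pose F : {linear U -> U'} := HB.pack f (GRing.isLinear.Build k U U' *:%R f fL).
have [|g [gL gf]] := @linear_extension k U' U [set p | p.1 = f p.2]%classic
  (@field_baer_injective k U).
  split=> /= [|a x y x' y' -> ->|y].
  - exact/esym/(linear0 F).
  - by rewrite fL.
  - by move=> fy; apply: f_inj; rewrite -fy; apply/esym/(linear0 F).
by exists g; split=> // x; apply/esym/gf.
Qed.

Section DVR.
Variable k : fieldType.
Local Notation V := (loc0 k).
Local Notation t := (loc0_t k).

Lemma loc0_factor (v : V) : v != 0 ->
  exists n (u u' : V), v = t ^+ n * u /\ u * u' = 1.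
Proof.
case: v => x xP v0; have /loc0P[p [q [q0 Ex]]] := xP.
have p0 : p != 0.
  apply: contraNneq v0 => p0; apply/eqP/loc0_val_inj => /=.
  by rewrite Ex p0 tofrac0 mul0r.
have [n [r]] := multiplicity_XsubC p 0; rewrite p0 /= subr0 => r0 def_p.
have uP : (r%:F / q%:F : ratfun k) \in @loc0_pred k by apply/loc0P; exists r, q.
have u'P : (q%:F / r%:F : ratfun k) \in @loc0_pred k by apply/loc0P;
  exists q, r.
exists n, (Loc0 uP), (Loc0 u'P); split; apply: loc0_val_inj.
  by rewrite loc0_valM loc0_valX /= Ex def_p tofracM tofracXn mulrA [X in X /
    _]mulrC.
have rq0 : (r * q)%:F != 0 :> ratfun k.
  by apply: tofrac_neq0; rewrite hornerM mulf_neq0.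
rewrite loc0_valM loc0_val1 [LHS]mulf_div -!tofracM [q * r]mulrC.
exact: (divff rq0).
Qed.

(** An ideal of [V] is zero or generated by some [t^n], so a partial map on it
    is determined by its value at [t^n], and divisibility provides a
    quotient of this value by [t^n]. *)
Lemma divisible_baer_injective (I : lmodType V) :
  (forall w : I, exists z, w = t *: z) -> baer_injective I.
Proof.
move=> Idiv J Jlin; have [J00 JL J0] := Jlin.
have JZ a b w : J (b, w) -> J (a * b, a *: w).
  by move=> Jb; have := JL a _ _ _ _ Jb J00; rewrite !addr0.
have Idivn n (w : I) : exists z, w = t ^+ n *: z.
  elim: n w => [|n IH] w; first by exists w; rewrite expr0 scale1r.
  have [z ->] := Idiv w; have [z' ->] := IH z.
  by exists z'; rewrite scalerA -exprS.
have pow a w : J (a, w) -> a != 0 -> exists n u,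
    [/\ a = u * t ^+ n & exists w', J (t ^+ n, w')].
  move=> Ja /loc0_factor[n [u [u' [Ea uu']]]]; exists n, u.
  split; first by rewrite mulrC.
  exists (u' *: w); have := JZ u' _ _ Ja; congr J; congr pair.
  by rewrite Ea mulrCA [u' * u]mulrC uu' mulr1.
(* The ideal on which [J] is defined is generated by [t^n] for the least such
   [n]. *)
pose ord := fun n => `[< exists w, J (t ^+ n, w) >].
have [exJ|nJ] := pselect (exists n, ord n); last first.
  exists 0 => a w Jaw; rewrite scaler0; apply: J0.
  have [<- //|/(pow _ _ Jaw)[n [u [_ exw]]]] := eqVneq a 0.
  by case: nJ; exists n; apply/asboolP.
case: (ex_minnP exJ) => n /asboolP[w Jn] n_min; have [z Ew] := Idivn n w.
exists z => a v Jav; have [a0|/(pow _ _ Jav)[l [u [Ea exw]]]] := eqVneq a 0.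
  by rewrite a0 scale0r; apply: J0; rewrite -a0.
have nl : (n <= l)%N by apply: n_min; apply/asboolP.
apply: (linear_graph_eq Jlin Jav).
have -> : a = u * t ^+ (l - n) * t ^+ n by rewrite -mulrA -exprD subnK.
rewrite -scalerA -Ew; exact: JZ.
Qed.

End DVR.

Section AdditiveMaps.
Variables (S : comPzRingType) (Q : lmodType S) (W : zmodType).

Definition addmap_pred : pred (Q -> W) :=
  fun h => `[< {morph h : x y / x + y} >].

Fact addmap_zmod : zmod_closed addmap_pred.
Proof.
split; first by apply/asboolP => x y; rewrite addr0.
move=> f g /asboolP fD /asboolP gD; apply/asboolP => x y.
by rewrite /= !fctE fD gD opprD addrACA.
Qed.
HB.instance Definition _ := GRing.isZmodClosed.Build (Q ->
  W) addmap_pred addmap_zmod.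

Record addmap : Type :=
  AddMap { addmap_fun :> Q -> W; _ : addmap_fun \in addmap_pred }.
HB.instance Definition _ := [isSub for addmap_fun].
HB.instance Definition _ := [Choice of addmap by <:].
HB.instance Definition _ := [SubChoice_isSubZmodule of addmap by <:].

Lemma addmapD (h : addmap) : {morph h : x y / x + y}.
Proof. by case: h => h /= /asboolP. Qed.

Lemma addmapP (h h' : addmap) : h =1 h' -> h = h'.
Proof. by move=> e; apply: val_inj; apply: funext. Qed.

Fact addmap_scale_subproof (s : S) (h : addmap) :
  (fun x => h (s *: x)) \in addmap_pred.
Proof. by apply/asboolP => x y; rewrite scalerDr addmapD. Qed.

Definition addmap_scale s h : addmap := AddMap (addmap_scale_subproof s h).

Fact addmap_scaleA a b h :
  addmap_scale a (addmap_scale b h) = addmap_scale (a * b) h.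
Proof. by apply: addmapP => x /=; rewrite scalerA mulrC. Qed.
Fact addmap_scale1 : left_id 1 addmap_scale.
Proof. by move=> h; apply: addmapP => x /=; rewrite scale1r. Qed.
Fact addmap_scaleDr : right_distributive addmap_scale +%R.
Proof. by move=> a h h'; apply: addmapP. Qed.
Fact addmap_scaleDl h : {morph addmap_scale^~ h : a b / a + b}.
Proof. by move=> a b; apply: addmapP => x /=; rewrite scalerDl addmapD. Qed.
HB.instance Definition _ := GRing.Zmodule_isLmodule.Build S addmap
  addmap_scaleA addmap_scale1 addmap_scaleDr addmap_scaleDl.

End AdditiveMaps.

(** Let [W] be the tensor product of [Q] and [N]. The pure tensors give a
    linear map from [N] to [addmap Q W], which extends along [f] to [N'].
    Read as a balanced map on [Q] and [N'], the extension is a left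
    inverse of [Q (x) f]. *)
Lemma flat_of_injective_addmap (S : comPzRingType) (Q : lmodType S) :
  (forall W : zmodType, baer_injective (addmap Q W)) -> flat Q.
Proof.
move=> inj N N' f f_inj; set W : zmodType := tens Q N.
have [bl br bs] := pure_balanced Q N.
have pureP (n : N) : (fun q : Q => pure q n : W) \in @addmap_pred _ Q W.
  by apply/asboolP => x y; apply: bl.
have pure0 n : n = 0 -> AddMap (pureP n) = 0.
  move=> ->; apply: addmapP => q /=.
  by apply: (addrI (pure q 0)); rewrite -br !addr0.
have [|h [hL hE]] := @linear_extension S N' (addmap Q W)
  [set p | exists2 n, p.1 = f n & p.2 = AddMap (pureP n)]%classic (inj W).
  split=> /= [|a x y x' y' [n -> ->] [n' -> ->]|y [n fn ->]].
  - by exists 0; rewrite ?linear0 // pure0.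
  - exists (a *: n + n'); first by rewrite linearP.
    by apply: addmapP => q /=; rewrite br -bs.
  - by apply/pure0/f_inj; rewrite linear0.
pose b' q n' : W := h n' q.
pose h' : {linear N' -> addmap Q W} := HB.pack h
  (GRing.isLinear.Build S _ _ *:%R h hL).
have bal : balanced b'.
  split=> [n x y|q x y|s q n]; rewrite /b'; first exact: addmapD.
  - by rewrite -[h _]/(h' _) linearD.
  - by rewrite -[h (s *: n)]/(h' _) linearZ.
apply: (@can_inj _ _ _ (tens_lift b')) => x; move: x.
have idL : linear (@idfun Q) by [].
have fL : linear f by move=> a x y; rewrite linearP.
apply: tens_lift_ext => // [x y|q n].
  by rewrite (tens_mapD idL fL) (tens_liftD bal).
rewrite (tens_map_pure idL fL) (tens_lift_pure bal) /b' /=.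
by rewrite -(hE (f n) (AddMap (pureP n))) //; exists n.
Qed.

(** Additive maps on [Q] can be divided by [t] by composing them with a
    [k]-linear retraction of the multiplication by [t]. *)
Lemma torsion_free_flat (k : fieldType) (Q : lmodType (loc0 k)) :
  (forall q : Q, loc0_t k *: q = 0 -> q = 0) -> flat Q.
Proof.
move=> tQ; apply: flat_of_injective_addmap => W.
apply: divisible_baer_injective => h.
pose Qk := restr (in_alg (loc0 k)) Q.
pose m (q : Qk) : Qk := loc0_t k *: (q : Q).
have [||r [rL rK]] := @linear_retraction k Qk Qk m.
- move=> a x y; rewrite /m scalerDr; congr (_ + _).
  rewrite -[X in loc0_t k *: X = _]/(a%:A *: (x : Q)).
  by rewrite -[RHS]/(a%:A *: (_ *: (x : Q))) !scalerA mulrC.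
- move=> x y mxy; apply/eqP; rewrite -subr_eq0; apply/eqP.
  apply: (tQ ((x : Q) - (y : Q))).
  by rewrite scalerBr; apply/eqP; rewrite subr_eq0; apply/eqP.
have hrP : (fun q : Q => h (r q)) \in @addmap_pred _ Q W.
  apply/asboolP => x y; rewrite -addmapD; congr (addmap_fun _ _).
  by have := rL 1 x y; rewrite !scale1r.
exists (AddMap hrP); apply: addmapP => q /=.
by rewrite -[_ *: q]/(m q) rK.
Qed.

(** * Taylor expansion on the tensor product of M with k[t]_(t) *)

Section Taylor.
Variable k : fieldType.
Local Notation V := (loc0 k).
Local Notation t := (loc0_t k).

Lemma loc0_split (v : V) : exists cw : k * V, v = cw.1%:A + t * cw.2.
Proof.
case: v => x xP; have /loc0P[p [q [q0 Ex]]] := xP.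
pose c := p.[0] / q.[0].
have /factor_theorem[r] : root (p - c *: q) 0.
  by rewrite /root !hornerE /c divfK // subrr.
rewrite polyC0 subr0 => def_r.
have wP : (r%:F / q%:F : ratfun k) \in @loc0_pred k by apply/loc0P; exists r, q.
exists (c, Loc0 wP); apply: loc0_val_inj.
rewrite loc0_valD loc0_valM loc0_valZ loc0_val1 /= Ex.
rewrite -[c *: 1]/(c%:P%:F * 1) mulr1 mulrA -tofracM [_ * r]mulrC -def_r.
have qF := tofrac_neq0 q0.
rewrite -mul_polyC -[in X in _ = X + _](mulfK qF (c%:P%:F)) -tofracM -mulrDl.
by rewrite -tofracD addrC subrK.
Qed.

Lemma loc0_split0 (c : k) (w : V) : c%:A + t * w = 0 -> c = 0 /\ w = 0.
Proof.
have /loc0P[p [q [q0 Ex]]] : loc0_val w \in @loc0_pred k by case: w.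
move=> cw; have qF := tofrac_neq0 q0.
have h : c%:P%:F * 1 + ratfun_t k * (p%:F / q%:F) = 0 :> ratfun k.
  have := congr1 (@loc0_val k) cw.
  by rewrite loc0_valD loc0_valM loc0_valZ loc0_val1 Ex.
have {h} : (c *: q + 'X * p)%:F = 0 :> ratfun k.
  rewrite mulr1 in h.
  rewrite tofracD -mul_polyC !tofracM -[X in _ + X](divfK qF) -mulrDl.
  by rewrite -mulrA h mul0r.
move/eqP; rewrite tofrac_eq0 => /eqP h.
have c0 : c = 0.
  have := congr1 (horner^~ 0) h; rewrite !hornerE.
  by move/eqP; rewrite mulf_eq0 (negPf q0) orbF => /eqP.
split=> //; apply: loc0_val_inj; rewrite Ex.
move: h; rewrite c0 scale0r add0r => /eqP.
by rewrite mulf_eq0 polyX_eq0 /= => /eqP ->; rewrite tofrac0 mul0r.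
Qed.

(** The value of [v] at [t = 0]. *)
Definition loc0_ev (v : V) : k := (sval (cid (loc0_split v))).1.
(** The quotient of [v - v(0)] by [t]. *)
Definition loc0_quot (v : V) : V := (sval (cid (loc0_split v))).2.

Lemma loc0_evE (v : V) : v = (loc0_ev v)%:A + t * loc0_quot v.
Proof. by rewrite /loc0_ev /loc0_quot; case: cid. Qed.

Lemma loc0_split_uniq (v : V) c w : v = c%:A + t * w ->
  loc0_ev v = c /\ loc0_quot v = w.
Proof.
move=> Ev; have [] := @loc0_split0 (loc0_ev v - c) (loc0_quot v - w).
  by rewrite scalerBl mulrBr addrACA -opprD -loc0_evE Ev subrr.
by move=> /eqP + /eqP; rewrite !subr_eq0 => /eqP + /eqP.
Qed.

Lemma loc0_split_linear a (v w : V) :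
  loc0_ev (a *: v + w) = a * loc0_ev v + loc0_ev w /\
  loc0_quot (a *: v + w) = a *: loc0_quot v + loc0_quot w.
Proof.
apply: loc0_split_uniq; rewrite {1}(loc0_evE v) {1}(loc0_evE w).
by rewrite scalerDr scalerA scalerDl mulrDr -scalerAr addrACA.
Qed.

Lemma loc0_evD (v w : V) : loc0_ev (v + w) = loc0_ev v + loc0_ev w.
Proof. by have [] := loc0_split_linear 1 v w; rewrite scale1r mul1r. Qed.

Lemma loc0_quotD (v w : V) : loc0_quot (v + w) = loc0_quot v + loc0_quot w.
Proof. by have [] := loc0_split_linear 1 v w; rewrite !scale1r. Qed.

Lemma loc0_split_t (v : V) : loc0_ev (t * v) = 0 /\ loc0_quot (t * v) = v.
Proof. by apply: loc0_split_uniq; rewrite scale0r add0r. Qed.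

Lemma loc0_split_const (c : k) : loc0_ev c%:A = c /\ loc0_quot c%:A = 0.
Proof. by apply: loc0_split_uniq; rewrite mulr0 addr0. Qed.

Lemma loc0_splitZ a (v : V) :
  loc0_ev (a *: v) = a * loc0_ev v /\ loc0_quot (a *: v) = a *: loc0_quot v.
Proof.
have [e0 s0] := loc0_split_const 0; rewrite scale0r in e0 s0.
by have := loc0_split_linear a v 0; rewrite e0 s0 !addr0.
Qed.

End Taylor.

Section Series.
Variables (k : fieldType) (R : algType k) (M : lmodType R).
Local Notation V := (loc0 k).
Local Notation RV := (tensalg R V).
Local Notation F := (tensmod M V^o).
Local Notation t := (tens_t R).
Local Notation mp m v := (mpure (m : M) (v : V^o)).

Section Balanced.
Variable B : algType k.
Local Notation FB := (tensmod M B^o).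

Lemma mpure_balanced : [/\ forall b : B^o, {morph (fun m :
  M => mpure m b) : x y / x + y},
      forall m : M, {morph (fun b : B^o => mpure m b) : x y / x + y}
    & forall c (m : M) (b : B), mpure (c%:A *: m) (b :
      B^o) = mpure m (c *: b : B^o)].
Proof.
have [bl br bs] := pure_balanced (restr (in_alg R) M) (restr (in_alg B) B^o).
split=> // c m b; rewrite -[c *: b]mulr_algl; exact: bs.
Qed.

Lemma tensmod_ext (W : zmodType) (f g : FB -> W) :
  {morph f : x y / x + y} -> {morph g : x y / x + y} ->
  (forall m (b : B), f (mpure m (b : B^o)) = g (mpure m (b : B^o))) -> f =1 g.
Proof. exact: tens_lift_ext. Qed.

Lemma tensmod_ind (P : FB -> Prop) : P 0 ->
  (forall m (b : B), P (mpure m (b : B^o))) ->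
  (forall x y, P x -> P y -> P (x + y)) -> forall x, P x.
Proof.
move=> P0 Pp PD x; refine (tens_ind P0 _ x) => m b y Py.
by apply: PD => //; exact: Pp.
Qed.

Section Map.
Variables (W : zmodType) (f : M -> B -> W).
Hypotheses (fl : forall b, {morph f^~ b : x y / x + y})
  (fr : forall m, {morph f m : x y / x + y})
  (fs : forall c m b, f (c%:A *: m) b = f m (c *: b)).

Definition tensmod_map : FB -> W :=
  @tens_lift _ (restr (in_alg R) M) (restr (in_alg B) B^o) W f.

Let bal : @balanced _ (restr (in_alg R) M) (restr (in_alg B) B^o) W f.
Proof.
split=> // c m b; rewrite [LHS]fs -mulr_algl; done.
Qed.

Lemma tensmod_mapE m b : tensmod_map (mpure m (b : B^o)) = f m b.
Proof. exact: (tens_lift_pure bal). Qed.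

Lemma tensmod_mapD : {morph tensmod_map : x y / x + y}.
Proof. exact: (tens_liftD bal). Qed.

End Map.

End Balanced.

Let algZ (c : k) (r : R) (m : M) : r *: (c%:A *: m) = c%:A *: (r *: m).
Proof. by rewrite !scalerA mulr_algr mulr_algl. Qed.

(** The reduction of [M (x) V] modulo [t], with values in [M (x) k = M]. *)
Definition const_term : F -> M :=
  tensmod_map (fun (m : M) (v : V) => (loc0_ev v)%:A *: m).

Let ev_l (b : V) : {morph (fun m : M => (loc0_ev b)%:A *: m) : x y / x + y}.
Proof. by move=> x y; rewrite scalerDr. Qed.
Let ev_r (m : M) : {morph (fun b : V => (loc0_ev b)%:A *: m) : x y / x + y}.
Proof. by move=> x y; rewrite loc0_evD !scalerDl. Qed.
Let ev_s c (m : M) (b : V) :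
  (loc0_ev b)%:A *: (c%:A *: m) = (loc0_ev (c *: b))%:A *: m.
Proof.
by rewrite (loc0_splitZ c b).1 scalerA mulr_algr scalerA.
Qed.

Lemma const_termE m v : const_term (mp m v) = (loc0_ev v)%:A *: m.
Proof. exact: (tensmod_mapE ev_l ev_r ev_s). Qed.

Lemma const_termD : {morph const_term : x y / x + y}.
Proof. exact: (tensmod_mapD ev_l ev_r ev_s). Qed.

(** The quotient of [x - x(0)] by [t], see [tensmod_split]. *)
Definition tquot : F -> F :=
  tensmod_map (fun (m : M) (v : V) => mp m (loc0_quot v)).

Let sg_l (b : V) : {morph (fun m : M => mp m (loc0_quot b)) : x y / x + y}.
Proof. by have [bl _ _] := mpure_balanced V; apply: bl. Qed.
Let sg_r (m : M) : {morph (fun b : V => mp m (loc0_quot b)) : x y / x + y}.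
Proof. by have [_ br _] := mpure_balanced V => x y; rewrite loc0_quotD br. Qed.
Let sg_s c (m : M) (b : V) :
  mp (c%:A *: m) (loc0_quot b) = mp m (loc0_quot (c *: b)).
Proof.
by have [_ _ bs] := mpure_balanced V; rewrite bs (loc0_splitZ c b).2.
Qed.

Lemma tquotE m v : tquot (mp m v) = mp m (loc0_quot v).
Proof. exact: (tensmod_mapE sg_l sg_r sg_s). Qed.

Lemma tquotD : {morph tquot : x y / x + y}.
Proof. exact: (tensmod_mapD sg_l sg_r sg_s). Qed.

Lemma tens_tE m v : t *: mp m v = mp m (loc0_t k * v).
Proof. by rewrite tensmod_pureE scale1r. Qed.

Lemma const_term_t x : const_term (t *: x) = 0.
Proof.
move: x; apply: tensmod_ext => [x y|x y|m v]; rewrite ?addr0 //.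
  by rewrite scalerDr const_termD.
by rewrite tens_tE const_termE (loc0_split_t v).1 scale0r scale0r.
Qed.

Lemma tquot_t x : tquot (t *: x) = x.
Proof.
move: x; apply: tensmod_ext => [x y|//|m v].
  by rewrite scalerDr tquotD.
by rewrite tens_tE tquotE (loc0_split_t v).2.
Qed.

Lemma const_term_const m : const_term (mp m 1) = m.
Proof.
have [+ _] := @loc0_split_const k 1; rewrite scale1r const_termE => ->.
by rewrite !scale1r.
Qed.

Lemma tquot_const m : tquot (mp m 1) = 0.
Proof.
have [_ +] := @loc0_split_const k 1; rewrite scale1r tquotE => ->.
have [_ br _] := mpure_balanced V.
by apply: (addrI (mp m 0)); rewrite -br !addr0.
Qed.

Lemma tensmod_split x : x = mp (const_term x) 1 + t *: tquot x.
Proof.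
have [bl br bs] := mpure_balanced V.
move: x; apply: tensmod_ext => // [x y|m v].
  by rewrite const_termD tquotD bl scalerDr addrACA.
rewrite const_termE tquotE tens_tE bs -br; congr mpure.
exact: loc0_evE.
Qed.

Lemma const_termZ r x : const_term (tens_inl R V r *: x) = r *: const_term x.
Proof.
move: x; apply: tensmod_ext => [x y|x y|m v].
- by rewrite scalerDr const_termD.
- by rewrite const_termD scalerDr.
by rewrite tensmod_pureE scale1r !const_termE algZ.
Qed.

Lemma tquotZ r x : tquot (tens_inl R V r *: x) = tens_inl R V r *: tquot x.
Proof.
move: x; apply: tensmod_ext => [x y|x y|m v].
- by rewrite scalerDr tquotD.
- by rewrite tquotD scalerDr.
by rewrite tensmod_pureE scale1r !tquotE tensmod_pureE scale1r.
Qed.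

Definition taylor (x : F) : nat -> M := fun j => const_term (iter j tquot x).

Lemma taylor_cons m x : taylor (mp m 1 + t *: x) 0%N = m /\
  (forall j, taylor (mp m 1 + t *: x) j.+1 = taylor x j).
Proof.
split=> [|j]; rewrite /taylor.
  by rewrite /= const_termD const_term_const const_term_t addr0.
by rewrite iterSr tquotD tquot_const tquot_t add0r.
Qed.

Lemma taylor_t x : taylor (t *: x) = tshift (taylor x).
Proof.
apply: funext => -[|j]; first exact: const_term_t.
by rewrite /taylor iterSr tquot_t.
Qed.

Lemma taylorD x y j : taylor (x + y) j = taylor x j + taylor y j.
Proof.
rewrite /taylor; elim: j x y => [|j IH] x y; first exact: const_termD.
by rewrite !iterSr tquotD IH.
Qed.

Lemma taylorZ r x j : taylor (tens_inl R V r *: x) j = r *: taylor x j.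
Proof.
rewrite /taylor; elim: j x => [|j IH] x; first exact: const_termZ.
by rewrite !iterSr tquotZ IH.
Qed.

(** The expansion of [x] determines [x] modulo every power of [t], and
    a lattice contains all elements divisible by a high power of [t]; so
    lattices can be compared on either side of the expansion. *)
Lemma taylor_vanish n x : (forall j, (j < n)%N -> taylor x j = 0) ->
  exists y, x = t ^+ n *: y.
Proof.
elim: n x => [|n IH] x x0; first by exists x; rewrite expr0 scale1r.
have [j jn|y Ey] := IH (tquot x).
  by rewrite -(x0 j.+1) // /taylor iterSr.
exists y; rewrite exprS -scalerA -Ey {1}[x]tensmod_split.
have -> : const_term x = 0 by exact: x0 0%N (ltn0Sn _).
have [bl _ _] := mpure_balanced V.
have -> : mp 0 1 = 0 by apply: (addrI (mp 0 1)); rewrite -bl !addr0.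
by rewrite add0r.
Qed.

Lemma taylor_approx n (f : nat -> M) :
  exists x, forall j, (j < n)%N -> taylor x j = f j.
Proof.
elim: n f => [|n IH] f; first by exists 0.
have [x xP] := IH (fun j => f j.+1); exists (mp (f 0%N) 1 + t *: x).
have [t0 tS] := taylor_cons (f 0%N) x.
by move=> [|j] jn; [exact: t0|rewrite tS xP].
Qed.

Lemma tensmod_t_inj (x : F) : t *: x = 0 -> x = 0.
Proof.
move=> tx; have tquot0 : tquot 0 = 0.
  by apply: (addrI (tquot 0)); rewrite -tquotD !addr0.
by rewrite -[x]tquot_t tx tquot0.
Qed.

End Series.

(** * From a lattice of power series to a degeneration *)

Section Extension.
Variables (k : fieldType) (R : algType k) (M : lmodType R).
Local Notation V := (loc0 k).
Local Notation K := (ratfun k).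
Local Notation RV := (tensalg R V).
Local Notation RK := (tensalg R K).
Local Notation F := (tensmod M V^o).
Local Notation FK := (tensmod M K^o).
Local Notation t := (tens_t R).
Local Notation tK := (tens_inr R K (ratfun_t k)).
Local Notation mp m v := (mpure (m : M) (v : V^o)).
Local Notation mpK m x := (mpure (m : M) (x : K^o)).

Lemma tens_tX n : t ^+ n = tens_inr R V (loc0_t k ^+ n).
Proof. by rewrite /tens_t -rmorphXn. Qed.

Lemma tKX n : tK ^+ n = tens_inr R K (ratfun_t k ^+ n).
Proof. by rewrite rmorphXn. Qed.

Lemma tensalg_ind (B : algType k) (P : tensalg R B -> Prop) : P 0 ->
  (forall r b, P (pure r b)) -> (forall x y, P x -> P y -> P (x + y)) ->
  forall x, P x.
Proof.
move=> P0 Pp PD x; refine (tens_ind P0 _ x) => r b y Py.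
by apply: PD => //; exact: Pp.
Qed.

Lemma pure_inl_inr (B : algType k) (r : R) (b : B) :
  (pure r b : tensalg R B) = tens_inl R B r * tens_inr R B b.
Proof. by rewrite pureM mulr1 mul1r. Qed.

Lemma pure_inr_inl (B : algType k) (r : R) (b : B) :
  (pure r b : tensalg R B) = tens_inr R B b * tens_inl R B r.
Proof. by rewrite pureM mulr1 mul1r. Qed.

Let to_generic_l (b : V) : {morph (fun m :
  M => mpK m (loc0_val b)) : x y / x + y}.
Proof. by have [bl _ _] := mpure_balanced M K; apply: bl. Qed.
Let to_generic_r (m : M) : {morph (fun b :
  V => mpK m (loc0_val b)) : x y / x + y}.
Proof. by have [_ br _] := mpure_balanced M K => x y; rewrite loc0_valD br. Qed.
Let to_generic_s c (m : M) (b : V) :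
  mpK (c%:A *: m) (loc0_val b) = mpK m (loc0_val (c *: b)).
Proof. by have [_ _ bs] := mpure_balanced M K; rewrite bs loc0_valZ. Qed.

(** The canonical map from [M (x) V] to its generic fibre [M (x) K]. *)
Definition to_generic : F -> FK :=
  tensmod_map (fun (m : M) (v : V) => mpK m (loc0_val v)).

Lemma to_genericE m v : to_generic (mp m v) = mpK m (loc0_val v).
Proof. exact: (tensmod_mapE to_generic_l to_generic_r to_generic_s). Qed.

Lemma to_genericD : {morph to_generic : x y / x + y}.
Proof. exact: (tensmod_mapD to_generic_l to_generic_r to_generic_s). Qed.

Lemma to_generic0 : to_generic 0 = 0.
Proof. by apply: (addrI (to_generic 0)); rewrite -to_genericD !addr0. Qed.

Lemma to_generic_scale r v x :
  to_generic ((pure r v : RV) *: x) = (pure r (loc0_val v) :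
    RK) *: to_generic x.
Proof.
move: x; apply: tensmod_ext => [x y|x y|m w].
- by rewrite scalerDr to_genericD.
- by rewrite to_genericD scalerDr.
by rewrite tensmod_pureE !to_genericE tensmod_pureE -[v *: _]/(v * _) loc0_valM.
Qed.

Lemma to_generic_t n x : to_generic (t ^+ n *: x) = tK ^+ n *: to_generic x.
Proof.
by rewrite tKX tens_tX to_generic_scale loc0_valX.
Qed.

Lemma to_generic_denom z : exists n y, tK ^+ n *: z = to_generic y.
Proof.
elim/tensmod_ind: z => [|m x|z z'].
- by exists 0%N, 0; rewrite to_generic0 scaler0.
- have [n [v h]] := tloc_den1 x; exists n, (mp m v).
  by rewrite to_genericE -h tKX tensmod_pureE scale1r mulrC.
- move=> [n [y h]] [n' [y' h']]; exists (n + n')%N,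
  (t ^+ n' *: y + t ^+ n *: y').
  rewrite to_genericD !to_generic_t -h -h' scalerDr !scalerA -!exprD.
  by rewrite [(n' + n)%N]addnC.
Qed.

Lemma tKn_inj n (z : FK) : tK ^+ n *: z = 0 -> z = 0.
Proof.
move=> tz; rewrite -[z]scale1r.
have -> : 1 = tens_inr R K ((ratfun_t k) ^- n) * tK ^+ n.
  rewrite tKX pureM mulr1 mulVf //; exact/expf_neq0/ratfun_t_neq0.
by rewrite -scalerA tz scaler0.
Qed.

(** A [k]-linear retraction of the inclusion of [V] into [K] induces a left
    inverse. *)
Lemma to_generic_inj : injective to_generic.
Proof.
have valL : linear (@loc0_val k : V -> K).
  by move=> a x y; rewrite loc0_valD loc0_valZ.
have [rho [rhoL rhoK]] := linear_retraction valL (@loc0_val_inj k).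
pose rho' : {linear K -> V} := HB.pack rho
  (GRing.isLinear.Build k K V *:%R rho rhoL).
have [bl br bs] := mpure_balanced M V.
pose f (m : M) (x : K) : F := mp m (rho x).
have fl x : {morph f^~ x : m m' / m + m'} by move=> m m'; apply: bl.
have fr m : {morph f m : x y / x + y}.
  by move=> x y; rewrite /f -[rho (x + y)]/(rho' (x + y)) linearD br.
have fs c m x : f (c%:A *: m) x = f m (c *: x).
  by rewrite /f bs -[rho (c *: x)]/(rho' (c *: x)) linearZ.
apply: (@can_inj _ _ _ (tensmod_map f)) => x; move: x.
apply: tensmod_ext => // [x y|m v].
  by rewrite to_genericD (tensmod_mapD fl fr fs).
by rewrite to_genericE (tensmod_mapE fl fr fs) /f rhoK.
Qed.

Lemma tensmod_tn_inj n (x : F) : t ^+ n *: x = 0 -> x = 0.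
Proof.
elim: n => [|n IH]; first by rewrite expr0 scale1r.
by rewrite exprS -scalerA => /tensmod_t_inj.
Qed.

Lemma taylor_tn n (x : F) j : (j < n)%N -> taylor (t ^+ n *: x) j = 0.
Proof.
elim: n j => [//|n IH] j jn; rewrite exprS -scalerA taylor_t.
by case: j jn => [|j] jn //=; rewrite IH.
Qed.

End Extension.

Section SpecialFibre.
Variables (k : fieldType) (R : algType k) (Q : lmodType (tensalg R (loc0 k))).
Variables (N : lmodType R) (g : Q -> N).
Hypotheses (gD : {morph g : x y / x + y})
  (gZ : forall r q, g (tens_inl R (loc0 k) r *: q) = r *: g q)
  (g_surj : forall n, exists q, g q = n)
  (gt : forall q, g (tens_t R *: q) = 0)
  (g_ker : forall q, g q = 0 -> exists q', q = tens_t R *: q').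

Lemma special_fibre_iso :
  mod_iso (restr (tens_inl R (loc0 k)) (quotmod (tsub Q))) N.
Proof.
have gB x y : g (x - y) = g x - g y by apply: (canRL (addrK _));
  rewrite -gD subrK.
pose f (u : quotmod (tsub Q)) : N := g (repr u).
have fE q : f (\pi_(quotmod (tsub Q)) q) = g q.
  apply/eqP; rewrite -subr_eq0 /f -gB.
  have /tsub_predP[q' ->] : repr (\pi_(quotmod (tsub Q)) q) - q \in tsub Q.
    by apply/quotmodP; rewrite reprK.
  by rewrite gt.
apply: (@mod_iso_intro _ (restr (tens_inl R (loc0 k)) (quotmod (tsub Q))) N f).
- move=> a; elim/quotW => x; elim/quotW => y.
  rewrite -[a *: _]/(tens_inl R (loc0 k) a *: \pi_(quotmod (tsub Q)) x).
  by rewrite -quotmodZ -[_ + _]quotmodD !fE gD gZ.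
- elim/quotW => x; elim/quotW => y; rewrite !fE => gxy; apply/quotmodP.
  by apply/tsub_predP/g_ker; rewrite gB gxy subrr.
- by move=> n; have [q <-] := g_surj n; exists (\pi_(quotmod (tsub Q)) q).
Qed.

End SpecialFibre.

Lemma fin_gen_sum (A : pzRingType) (M : lmodType A) p q
    (x : 'I_p -> M) (y : 'I_q -> M) :
  (forall z, exists a b, z = \sum_i a i *: x i + \sum_j b j *: y j) ->
    fin_gen M.
Proof.
move=> gen.
exists (p + q)%N,
  (fun i => match fintype.split i with inl a => x a | inr b => y b end).
move=> z; have [a [b ->]] := gen z.
exists (fun i => match fintype.split i with inl i => a i | inr j => b j end).
rewrite big_split_ord /=; congr (_ + _); apply: eq_bigr => i _.
  by rewrite (unsplitK (inl i)).
by rewrite (unsplitK (inr i)).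
Qed.

Section LatticeModule.
Variables (k : fieldType) (R : algType k) (M N : lmodType R).
Variables (m : nat) (D : (nat -> M) -> N -> Prop).
Hypothesis DL : lattice_graph m D.
Local Notation V := (loc0 k).
Local Notation K := (ratfun k).
Local Notation RV := (tensalg R V).
Local Notation RK := (tensalg R K).
Local Notation F := (tensmod M V^o).
Local Notation FK := (tensmod M K^o).
Local Notation t := (tens_t R).
Local Notation mp m v := (mpure (m : M) (v : V^o)).
Local Notation mpK m x := (mpure (m : M) (x : K^o)).

Definition lattice_pred : pred F := fun x => `[< exists n, D (taylor x) n >].

Lemma lattice_predP x : reflect (exists n, D (taylor x) n) (x \in lattice_pred).
Proof. exact: asboolP. Qed.

Lemma taylor_graphD x y n n' :
  D (taylor x) n -> D (taylor y) n' -> D (taylor (x + y)) (n + n').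
Proof.
move=> Dx Dy; have := lattice_graphD DL Dx Dy; congr D.
by apply: funext => j; rewrite taylorD.
Qed.

Lemma taylor_graphZ r x n :
  D (taylor x) n -> D (taylor (tens_inl R V r *: x)) (r *: n).
Proof.
move=> Dx; have := lattice_graphZ DL r Dx; congr D.
by apply: funext => j; rewrite taylorZ.
Qed.

Lemma taylor_graph_t x n : D (taylor x) n -> D (taylor (t *: x)) 0.
Proof. by move=> Dx; rewrite taylor_t; exact: (lattice_shift DL Dx). Qed.

Let memD x y : x \in lattice_pred -> y \in lattice_pred ->
  x + y \in lattice_pred.
Proof.
move=> /lattice_predP[n Dx] /lattice_predP[n' Dy]; apply/lattice_predP.
by exists (n + n'); apply: taylor_graphD.
Qed.

Let memR r x : x \in lattice_pred -> tens_inl R V r *: x \in lattice_pred.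
Proof.
move=> /lattice_predP[n Dx]; apply/lattice_predP.
by exists (r *: n); apply: taylor_graphZ.
Qed.

Let memt x : x \in lattice_pred -> t *: x \in lattice_pred.
Proof.
by move=> /lattice_predP[n Dx]; apply/lattice_predP; exists 0;
  apply: taylor_graph_t Dx.
Qed.

Lemma lattice_pred_tail x : t ^+ m *: x \in lattice_pred.
Proof.
by apply/lattice_predP; apply: (lattice_tail DL) => j jm; rewrite taylor_tn.
Qed.

(** An element of [V] is a polynomial modulo [t^m], and [t^m (M (x) V)] is
    contained in the lattice, so stability under [k] and [t] gives
    stability under [V]. *)
Let memV v x : x \in lattice_pred -> tens_inr R V v *: x \in lattice_pred.
Proof.
move=> Qx.
suff approx n w : exists y z,
    tens_inr R V w *: x = z + t ^+ n *: y /\ z \in lattice_pred.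
  by have [y [z [-> Qz]]] := approx m v; apply: memD => //;
    apply: lattice_pred_tail.
elim: n w => [|n IH] w.
  exists (tens_inr R V w *: x), 0; rewrite expr0 scale1r add0r; split=> //.
  apply/lattice_predP; exists 0; apply: (lattice_graph_tail0 DL) => j _.
  by apply: (addrI (taylor (0 : F) j)); rewrite -taylorD !addr0.
have [y [z [Ew Qz]]] := IH (loc0_quot w).
exists y, (tens_inl R V (loc0_ev w)%:A *: x + t *: z).
split; last by apply: memD; [apply: memR|apply: memt].
rewrite exprS -scalerA -addrA -scalerDr -Ew {1}(loc0_evE w) rmorphD scalerDl.
rewrite [_ (_ * _)]rmorphM -scalerA; congr (_ *: _ + _).
have [_ _ bs] := pure_balanced R V.
exact: (esym (bs (loc0_ev w) 1 1)).
Qed.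

Fact lattice_submod : subsemimod_closed lattice_pred.
Proof.
have mem0 : 0 \in lattice_pred.
  by rewrite -[0](scaler0 _ (t ^+ m)) lattice_pred_tail.
split; first by split=> // x y; apply: memD.
move=> a x Qx; elim/tensalg_ind: a => [|r v|a b Qa Qb].
- by rewrite scale0r.
- by rewrite pure_inl_inr -scalerA; apply/memR/memV.
- by rewrite scalerDl; apply: memD.
Qed.
HB.instance Definition _ :=
  GRing.isSubSemiModClosed.Build RV F lattice_pred lattice_submod.

Record lattice : Type :=
  Lattice { lattice_val : F; _ : lattice_val \in lattice_pred }.
HB.instance Definition _ := [isSub for lattice_val].
HB.instance Definition _ := [Choice of lattice by <:].
HB.instance Definition _ := [SubChoice_isSubLmodule of lattice by <:].

Lemma lattice_valD (x y : lattice) :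
  lattice_val (x + y) = lattice_val x + lattice_val y.
Proof. exact: (linearD (val : lattice -> F)). Qed.

Lemma lattice_valZ a (x : lattice) : lattice_val (a *: x) = a *: lattice_val x.
Proof. exact: (linearZ_LR (val : lattice -> F)). Qed.

Lemma lattice_val_inj : injective lattice_val. Proof. exact: val_inj. Qed.

Lemma lattice_t_inj (q : lattice) : t *: q = 0 -> q = 0.
Proof.
move=> tq; apply: lattice_val_inj; apply: tensmod_t_inj.
by rewrite -lattice_valZ tq.
Qed.

Let fibre_ex (q : lattice) : exists n, D (taylor (lattice_val q)) n.
Proof. by case: q => x Qx; apply/lattice_predP. Qed.

Definition fibre (q : lattice) : N := sval (cid (fibre_ex q)).

Lemma fibreE q n : D (taylor (lattice_val q)) n -> fibre q = n.
Proof.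
by rewrite /fibre; case: cid => n' /= Dn' Dn;
  apply: (lattice_graph_uniq DL Dn').
Qed.

Lemma fibreP q : D (taylor (lattice_val q)) (fibre q).
Proof. by rewrite /fibre; case: cid. Qed.

Lemma fibreD : {morph fibre : x y / x + y}.
Proof.
by move=> x y; apply: fibreE; rewrite lattice_valD; apply: taylor_graphD;
  apply: fibreP.
Qed.

Lemma fibreZ r q : fibre (tens_inl R V r *: q) = r *: fibre q.
Proof.
by apply: fibreE; rewrite lattice_valZ; apply: taylor_graphZ; apply: fibreP.
Qed.

Lemma fibre_t q : fibre (t *: q) = 0.
Proof.
by apply: fibreE; rewrite lattice_valZ; apply: taylor_graph_t (fibreP q).
Qed.

Lemma fibre_surj n : exists q, fibre q = n.
Proof.
have [f Df] := lattice_surj DL n; have [x xf] := taylor_approx m.+1 f.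
have Dx : D (taylor x) n.
  by apply: (lattice_graph_congr DL _ Df) => j jm; rewrite xf.
have Qx : x \in lattice_pred by apply/lattice_predP; exists n.
by exists (Lattice Qx); apply: fibreE.
Qed.

Lemma fibre_ker q : fibre q = 0 -> exists q', q = t *: q'.
Proof.
move=> q0; have := fibreP q; rewrite q0 => /(lattice_ker DL)[g [n [Eg Dg]]].
have [|y Ey] := @taylor_vanish _ _ _ 1%N (lattice_val q).
  by move=> [|//] _; rewrite Eg.
rewrite expr1 in Ey.
have Qy : y \in lattice_pred.
  apply/lattice_predP; exists n; have := Dg; congr D; apply: funext => j.
  by have := congr1 (@^~ j.+1) Eg; rewrite Ey taylor_t => /= ->.
by exists (Lattice Qy); apply: lattice_val_inj; rewrite lattice_valZ.
Qed.

(** The multiplication by [t^m] as a map from [M (x) V] into the lattice. *)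
Definition tlift (x : F) : lattice := Lattice (lattice_pred_tail x).

Lemma tlift_scale a x : tlift (a *: x) = a *: tlift x.
Proof.
apply: lattice_val_inj; rewrite lattice_valZ /= !scalerA.
by congr (_ *: _); apply/esym/commrX; rewrite /GRing.comm tens_t_comm.
Qed.

Lemma tliftD : {morph tlift : x y / x + y}.
Proof.
by move=> x y; apply: lattice_val_inj; rewrite lattice_valD /= scalerDr.
Qed.

Lemma tlift_val q : tlift (lattice_val q) = t ^+ m *: q.
Proof. by apply: lattice_val_inj; rewrite lattice_valZ. Qed.

(** Generators of [N] are lifted to the lattice [Q]. They generate [Q] modulo
    [tQ], hence modulo [t^m Q], and [t^m Q] lies in [t^m (M (x) V)], which
    is generated by the images of the generators of [M]. *)
Lemma lattice_fin_gen : fin_gen M -> fin_gen N -> fin_gen lattice.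
Proof.
move=> [p [x gen_x]] [q [y gen_y]].
have [ly lyE] := choice (fun j => fibre_surj (y j)).
apply: (@fin_gen_sum _ _ p q (fun i => tlift (mp (x i) 1)) ly).
pose sp (z : lattice) := exists a b,
  z = \sum_i a i *: tlift (mp (x i) 1) + \sum_j b j *: ly j.
have spD z z' : sp z -> sp z' -> sp (z + z').
  move=> [a [b ->]] [a' [b' ->]].
  exists (fun i => a i + a' i), (fun j => b j + b' j).
  rewrite addrACA -!big_split; congr (_ + _); apply: eq_bigr => i _ /=;
  by rewrite scalerDl.
have spZ c z : sp z -> sp (c *: z).
  move=> [a [b ->]]; exists (fun i => c * a i), (fun j => c * b j).
  by rewrite scalerDr !scaler_sumr; congr (_ + _); apply: eq_bigr => i _;
    rewrite scalerA.
have sp0 : sp 0.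
  exists (fun=> 0), (fun=> 0).
  by rewrite !big1 ?addr0 // => i _; rewrite scale0r.
have sp_tail z : sp (tlift z).
  elim/tensmod_ind: z => [|u v|z z' sz sz'].
  - by have := tlift_scale 0 0; rewrite !scale0r => ->.
  - have [c ->] := gen_x u; exists (fun i => pure (c i) v), (fun=> 0).
    rewrite [X in _ + X]big1 ?addr0 => [|j _]; last by rewrite scale0r.
    have [bl _ _] := mpure_balanced M V.
    have bl0 : mp 0 v = 0 by apply: (addrI (mp 0 v)); rewrite -bl !addr0.
    have t0 : tlift 0 = 0 by have := tlift_scale 0 0; rewrite !scale0r.
    rewrite (big_morph (fun u => mp u v) (bl v) bl0) (big_morph _ tliftD t0).
    apply: eq_bigr => i _; rewrite -tlift_scale tensmod_pureE.
    by rewrite -[v *: 1]/(v * 1) mulr1.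
  - by rewrite tliftD; apply: spD.
move=> z.
have approx n : exists z' z'', z = z' + t ^+ n *: z'' /\ sp z'.
  elim: n => [|n [z' [z'' [Ez sz']]]].
    by exists 0, z; rewrite expr0 scale1r add0r.
  have [c Ec] := gen_y (fibre z'').
  pose w := \sum_j tens_inl R V (c j) *: ly j.
  have sw : sp w.
    exists (fun=> 0), (fun j => tens_inl R V (c j)).
    by rewrite [X in X + _]big1 ?add0r // => i _; rewrite scale0r.
  have fib0 : fibre 0 = 0 by apply: (addrI (fibre 0)); rewrite -fibreD !addr0.
  have fw : fibre w = fibre z''.
    rewrite Ec /w (big_morph _ fibreD fib0); apply: eq_bigr => j _.
    by rewrite fibreZ lyE.
  have [|w' Ew'] := @fibre_ker (z'' - w).
    by apply: (addIr (fibre w)); rewrite -fibreD subrK fw add0r.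
  exists (z' + t ^+ n *: w), w'; split; last by apply: spD => //; apply: spZ.
  by rewrite exprSr -scalerA -Ew' -addrA -scalerDr [w + _]addrC subrK.
have [z' [z'' [-> sz']]] := approx m.
by rewrite -tlift_val; apply: spD.
Qed.

Lemma lattice_flat : flat (restr (tens_inr R V) lattice).
Proof. exact/torsion_free_flat/lattice_t_inj. Qed.

Lemma tloc_scale_inl r (q : lattice) n :
  tens_inl R K r *: tfrac q n = tfrac (tens_inl R V r *: q) n.
Proof.
by rewrite /tens_inl (@tloc_scaleE _ _ _ r 1 0 1) // expr0 mulr1 loc0_val1.
Qed.

Let theta0 (u : M) (x : K) : tloc lattice :=
  tens_inr R K x *: tfrac (tlift (mp u 1)) m.

Let theta_l (x : K) : {morph theta0^~ x : u u' / u + u'}.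
Proof.
move=> u u'; rewrite /theta0; have [-> _ _] := mpure_balanced M V.
by rewrite tliftD -tfracD scalerDr.
Qed.
Let theta_r (u : M) : {morph theta0 u : x x' / x + x'}.
Proof. by move=> x x'; rewrite /theta0 rmorphD scalerDl. Qed.
Let theta_inl r u x : theta0 (r *: u) x = (pure r x :
  RK) *: tfrac (tlift (mp u 1)) m.
Proof.
rewrite /theta0 pure_inr_inl -scalerA tloc_scale_inl -tlift_scale.
by rewrite tensmod_pureE scale1r.
Qed.
Let theta_s c (u : M) (x : K) : theta0 (c%:A *: u) x = theta0 u (c *: x).
Proof.
rewrite theta_inl; have [_ _ bs] := pure_balanced R K.
by rewrite bs.
Qed.

Let theta : FK -> tloc lattice := tensmod_map theta0.

Let thetaD : {morph theta : x y / x + y}.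
Proof. exact: (tensmod_mapD theta_l theta_r theta_s). Qed.

Let thetaE u x : theta (mpK u x) = theta0 u x.
Proof. exact: (tensmod_mapE theta_l theta_r theta_s). Qed.

Let theta0E : theta 0 = 0.
Proof. by apply: (addrI (theta 0)); rewrite -thetaD !addr0. Qed.

Let thetaZ a z : theta (a *: z) = a *: theta z.
Proof.
elim/tensmod_ind: z a => [a|u x a|z z' IH IH' a].
- by rewrite !(scaler0, theta0E).
- elim/tensalg_ind: a => [|r y|a b IH IH'].
  + by rewrite !scale0r theta0E.
  + by rewrite tensmod_pureE !thetaE theta_inl /theta0 scalerA pureM mulr1.
  + by rewrite !scalerDl thetaD IH IH'.
- by rewrite !(scalerDr, thetaD) IH IH'.
Qed.

Let theta_to_generic y : theta (to_generic y) = tfrac (tlift y) m.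
Proof.
have tlift0 : tlift 0 = 0 by have := tlift_scale 0 0; rewrite !scale0r.
elim/tensmod_ind: y => [|u v|y y' IH IH'].
- rewrite to_generic0 theta0E tlift0 -[0 in LHS]/(tfrac 0 0).
  by rewrite (tfrac_shift m 0 0) scaler0.
- rewrite to_genericE thetaE /theta0 /tens_inr (@tloc_scaleE _ _ _ 1 _ 0 v)
  ?expr0 ?mulr1 //.
  by rewrite -tlift_scale tensmod_pureE scale1r -[v *: _]/(v * 1) mulr1.
- by rewrite to_genericD thetaD IH IH' tliftD tfracD.
Qed.

(** The inverse map sends [u (x) x] to [x (t^m u) / t^m], where [t^m u] is in
    the lattice. *)
Lemma lattice_generic_iso : mod_iso (tloc lattice) FK.
Proof.
apply: mod_iso_sym; apply: (@mod_iso_intro _ FK (tloc lattice) theta).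
- by move=> a x y; rewrite thetaD thetaZ.
- move=> z z' zz'; apply/eqP; rewrite -subr_eq0; apply/eqP.
  have : theta (z - z') = 0.
    by apply: (addIr (theta z')); rewrite -thetaD subrK zz' add0r.
  move: (z - z') => {zz'}z {z'} z0.
  have [n [y Ey]] := to_generic_denom z; apply: (@tKn_inj _ _ _ n); rewrite Ey.
  suff -> : y = 0 by rewrite to_generic0.
  have : tfrac (tlift y) m = tfrac 0 0.
    by rewrite -theta_to_generic -Ey thetaZ z0 scaler0.
  move=> /tfracP[i]; rewrite scaler0 => /(congr1 lattice_val).
  by rewrite lattice_valZ => /tensmod_tn_inj /tensmod_tn_inj.
- elim/tloc_ind => q n.
  exists (tens_inr R K (ratfun_t k ^- n) *: to_generic (lattice_val q)).
  rewrite thetaZ theta_to_generic tlift_val /tens_inr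
    (@tloc_scaleE _ _ _ 1 _ n 1).
    rewrite scale1r; exact/esym/tfrac_shift.
  by rewrite loc0_val1 mulVf // expf_neq0 // ratfun_t_neq0.
Qed.

Lemma lattice_graph_degenerates : fin_gen M -> fin_gen N -> degenerates M N.
Proof.
move=> fgM fgN; exists lattice; split.
- exact: lattice_fin_gen.
- exact: lattice_flat.
- exact: (special_fibre_iso fibreD fibreZ fibre_surj fibre_t fibre_ker).
- exact: lattice_generic_iso.
Qed.

End LatticeModule.

(** * From a degeneration to a lattice of power series *)

(** Flatness is applied to the multiplication by [s] on the ring. *)
Lemma flat_torsion_free (S : comPzRingType) (s : S) (Q : lmodType S) :
  injective ( *%R s) -> flat Q -> forall q : Q, s *: q = 0 -> q = 0.
Proof.
move=> s_inj Qflat q sq.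
pose f : S^o -> S^o := *%R s.
have fL : linear f by move=> a x y; rewrite /f mulrDr [s * (a *: x)]mulrCA.
pose f' : {linear S^o -> S^o} := HB.pack f
  (GRing.isLinear.Build S S^o S^o *:%R f fL).
have idL : linear (@idfun Q) by [].
have [bl br bs] := pure_balanced Q S^o.
have f'L : linear f' by [].
have q0 : pure q (1 : S^o) = 0.
  apply: (Qflat _ _ f' s_inj).
  have map0 : tens_map (@idfun Q) f' 0 = 0.
    by apply: (addrI (tens_map idfun f' 0));
      rewrite -(tens_mapD idL f'L) !addr0.
  rewrite map0 (tens_map_pure idL f'L) /=.
  rewrite -[f 1]/(s *: (1 : S^o)) -bs sq.
  by apply: (addrI (pure 0 (1 : S^o))); rewrite -bl !addr0.
have act_bal : @balanced _ Q S^o Q (fun q v => v *: q).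
  split=> [v x y|x v w|a x v]; first by rewrite scalerDr.
    by rewrite scalerDl.
  by rewrite scalerA mulrC.
have := congr1 (tens_lift (fun (q : Q) (v : S^o) => v *: q)) q0.
by rewrite (tens_lift_pure act_bal) (tens_lift0 act_bal) scale1r.
Qed.

Lemma loc0_t_mul_inj (k : fieldType) : injective ( *%R (loc0_t k)).
Proof.
move=> x y /(congr1 (@loc0_val k)); rewrite !loc0_valM.
by move=> /(mulfI (ratfun_t_neq0 k)) /loc0_val_inj.
Qed.

Section Degeneration.
Variables (k : fieldType) (R : algType k) (M N : lmodType R).
Local Notation V := (loc0 k).
Local Notation K := (ratfun k).
Local Notation RV := (tensalg R V).
Local Notation RK := (tensalg R K).
Local Notation F := (tensmod M V^o).
Local Notation FK := (tensmod M K^o).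
Local Notation t := (tens_t R).
Local Notation tK := (tens_inr R K (ratfun_t k)).
Local Notation mp m v := (mpure (m : M) (v : V^o)).

Lemma tKX_comm n (b : RK) : tK ^+ n * b = b * tK ^+ n.
Proof.
rewrite tKX; elim/tensalg_ind: b => [|r x|b b' IH IH'].
- by rewrite mulr0 mul0r.
- by rewrite !pureM mul1r mulr1 mulrC.
- by rewrite mulrDl mulrDr IH IH'.
Qed.

Lemma to_generic_t1 (x : F) : to_generic (t *: x) = tK *: to_generic x.
Proof. exact: (to_generic_t 1). Qed.

Variable Q : lmodType RV.
Hypothesis Qt : forall q : Q, t *: q = 0 -> q = 0.
Variable phi : {linear tloc Q -> FK}.
Hypothesis phi_bij : bijective phi.

(** The lattice [Q] is regarded inside [M (x) K] through the isomorphism of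
    generic fibres. *)
Definition embed (q : Q) : FK := phi (tfrac q 0).

Lemma embedD : {morph embed : x y / x + y}.
Proof. by move=> x y; rewrite /embed -tfracD linearD. Qed.

Lemma embed0 : embed 0 = 0. Proof. exact: linear0. Qed.

Lemma embed_scale r v q :
  embed ((pure r v : RV) *: q) = (pure r (loc0_val v) : RK) *: embed q.
Proof.
rewrite /embed -linearZ /=; congr (phi _).
by rewrite (@tloc_scaleE _ _ _ r _ 0 v) // expr0 mulr1.
Qed.

Lemma embed_t n q : embed (t ^+ n *: q) = tK ^+ n *: embed q.
Proof. by rewrite tens_tX embed_scale tKX loc0_valX. Qed.

Lemma embed_t1 q : embed (t *: q) = tK *: embed q.
Proof. exact: (embed_t 1). Qed.

Lemma embed_inj : injective embed.
Proof.
move=> x y /(bij_inj phi_bij)/tfracP[n]; rewrite addn0.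
elim: n => [|n IH]; first by rewrite !expr0 !scale1r.
rewrite exprS -!scalerA => h; apply: IH; apply/eqP.
by rewrite -subr_eq0; apply/eqP/Qt; rewrite scalerBr h subrr.
Qed.

(** Each of the finitely many generators of [Q] has a denominator [t^n], and
    so [t^a Q] is contained in [M (x) V] for a suitable [a]. *)
Lemma embed_bounded : fin_gen Q ->
  exists a, forall q, exists x, tK ^+ a *: embed q = to_generic x.
Proof.
move=> [n [x gen_x]].
have bounds i : exists nx : nat * F, tK ^+ nx.1 *: embed (x i) = to_generic
  nx.2.
  by have [l [y h]] := to_generic_denom (embed (x i)); exists (l, y).
have [b bP] := choice bounds.
exists (\sum_i (b i).1)%N => q; set a := (\sum_i _)%N.
pose P q := exists y, tK ^+ a *: embed q = to_generic y.
have PD q1 q2 : P q1 -> P q2 -> P (q1 + q2).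
  move=> [y1 E1] [y2 E2]; exists (y1 + y2).
  by rewrite embedD scalerDr E1 E2 to_genericD.
have P0 : P 0 by exists 0; rewrite embed0 scaler0 to_generic0.
have PZ c q1 : P q1 -> P (c *: q1).
  move=> [y Ey]; elim/tensalg_ind: c => [|r v|c c' Pc Pc'].
  - by rewrite scale0r.
  - exists ((pure r v : RV) *: y); rewrite to_generic_scale -Ey embed_scale.
    by rewrite !scalerA tKX_comm.
  - by rewrite scalerDl; apply: PD.
have [c ->] := gen_x q; rewrite -/(P _).
apply: (big_ind P) => // i _; apply: PZ.
exists (t ^+ (a - (b i).1) *: (b i).2);
  rewrite to_generic_t -bP scalerA -exprD subnK //.
by rewrite /a (bigD1 i) //= leq_addr.
Qed.

(** Likewise [t^b (M (x) V)] is contained in [Q], because [M] is finitely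
    generated. *)
Lemma embed_cobounded : fin_gen M ->
  exists b, forall y, exists q, embed q = tK ^+ b *: to_generic y.
Proof.
move=> [n [x gen_x]]; have [phi' _ phi'K] := phi_bij.
have bounds i : exists nq : nat * Q, embed nq.2 = tK ^+ nq.1 *: to_generic
  (mp (x i) 1).
  have [q [l Eq]] : exists q l, phi' (to_generic (mp (x i) 1)) = tfrac q l.
    by elim/tloc_ind: (phi' _) => q l; exists q, l.
  exists (l, q); rewrite -[to_generic _]phi'K Eq /embed -linearZ /=;
    congr (phi _).
  rewrite tKX [tens_inr R K _]/(pure 1 _)
    (@tloc_scaleE _ _ _ 1 _ 0 (loc0_t k ^+ l)).
    by rewrite -[pure 1 _]/(tens_inr R V _) -tens_tX; exact: tfrac_shift.
  by rewrite expr0 mulr1 loc0_valX.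
have [b bP] := choice bounds.
exists (\sum_i (b i).1)%N => y; set a := (\sum_i _)%N.
pose P y := exists q, embed q = tK ^+ a *: to_generic y.
have PD y1 y2 : P y1 -> P y2 -> P (y1 + y2).
  move=> [q1 E1] [q2 E2]; exists (q1 + q2).
  by rewrite to_genericD scalerDr -E1 -E2 embedD.
have P0 : P 0 by exists 0; rewrite embed0 to_generic0 scaler0.
rewrite -/(P y); elim/tensmod_ind: y => // u v.
have [bl br bs] := mpure_balanced M V.
have bl0 : mp 0 v = 0 by apply: (addrI (mp 0 v)); rewrite -bl !addr0.
have [c ->] := gen_x u; rewrite (big_morph (fun u => mp u v) (bl v) bl0).
apply: (big_ind P) => // i _.
have la : ((b i).1 <= a)%N by rewrite /a (bigD1 i) //= leq_addr.
exists ((pure (c i) v : RV) *: (t ^+ (a - (b i).1) *: (b i).2)).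
have -> : mp (c i *: x i) v = (pure (c i) v : RV) *: mp (x i) 1.
  by rewrite tensmod_pureE -[v *: 1]/(v * 1) mulr1.
rewrite to_generic_scale embed_scale embed_t bP [tK ^+ _ *:
  (tK ^+ _ *: _)]scalerA -exprD subnK //.
by rewrite !scalerA tKX_comm.
Qed.

Variable g : Q -> N.
Hypotheses (gD : {morph g : x y / x + y})
  (gZ : forall r q, g (tens_inl R V r *: q) = r *: g q)
  (g_surj : forall n, exists q, g q = n)
  (gt : forall q, g (t *: q) = 0)
  (g_ker : forall q, g q = 0 -> exists q', q = t *: q').

(** The lattice consists of the series that agree modulo [t^(a+b+1)] with the
    expansion of an element of [t^a Q]. At this precision the expansion
    determines the class in [Q / tQ]: since [t^b (M (x) V)] is contained
    in [Q], an element of [t^(a+b+1) (M (x) V)] lies in [t^(a+1) Q]. *)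
Lemma degeneration_lattice : fin_gen Q -> fin_gen M -> lattice_degenerates M N.
Proof.
move=> fgQ fgM; have [a aP] := embed_bounded fgQ.
have [b bP] := embed_cobounded fgM.
have taylor0 j : taylor (0 : F) j = 0.
  by apply: (addrI (taylor (0 : F) j)); rewrite -taylorD !addr0.
have taylorB (x y : F) j : taylor (x - y) j = taylor x j - taylor y j.
  by apply: (canRL (addrK _)); rewrite -taylorD subrK.
have div_t q x : tK ^+ a *: embed q = to_generic x ->
    (forall j, (j < (a + b).+1)%N -> taylor x j = 0) -> exists q', q = t *: q'.
  move=> Ex /taylor_vanish[y Ey]; have [q' Eq'] := bP y; exists q'.
  apply: embed_inj; apply/eqP; rewrite -subr_eq0; apply/eqP/(@tKn_inj _ _ _ a).
  rewrite scalerBr Ex Ey embed_t1 Eq' to_generic_t !scalerA -exprSr -exprD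
    addSn.
  exact: subrr.
exists (a + b).+1, (fun f n => exists q x,
  [/\ tK ^+ a *: embed q = to_generic x,
  forall j, (j < (a + b).+1)%N -> f j = taylor x j & g q = n]); split.
- move=> r f f' _ _ [q [x [Ex fx <-]]] [q' [x' [Ex' fx' <-]]].
  exists (tens_inl R V r *: q + q'), (tens_inl R V r *: x + x'); split.
  + rewrite embedD to_genericD scalerDr Ex'; congr (_ + _).
    by rewrite embed_scale to_generic_scale -Ex !scalerA tKX_comm.
  + by move=> j jc; rewrite taylorD taylorZ fx // fx'.
  + by rewrite gD gZ.
- move=> _ [q [x [Ex fx <-]]].
  by have [|q' ->] := div_t q x Ex; [move=> j /fx|rewrite gt].
- move=> n; have [q Eq] := g_surj n; have [x Ex] := aP q.
  by exists (taylor x), q, x.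
- move=> f _ [q [x [Ex fx _]]]; exists (t *: q), (t *: x); split.
  + by rewrite embed_t1 to_generic_t1 -Ex !scalerA -exprSr -exprS.
  + by move=> j jc; rewrite taylor_t; case: j jc => //= j jc;
    rewrite fx // ltnW.
  + exact: gt.
- move=> f [q [x [Ex fx /g_ker[q' Eq]]]]; have [x' Ex'] := aP q'.
  have {Ex} Ex : x = t *: x'.
    apply: to_generic_inj; rewrite to_generic_t1 -Ex Eq embed_t1 -Ex' !scalerA.
    by rewrite -exprSr -exprS.
  (* Here [x'] approximates [f / t] only modulo [t^(a+b)], one power less than
     needed; the missing term of order [a + b] comes from [Q] by the choice of
     [b]. *)
  have [y yP] := taylor_approx (a + b).+1 (fun j => f j.+1).
  have [j jab|z Ez] := @taylor_vanish _ _ _ (a + b)%N (y - x').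
    by rewrite taylorB yP ?fx ?Ex ?taylor_t ?subrr // ltnW.
  have [q3 Eq3] := bP z.
  exists (fun j => f j.+1), (g (q' + q3)); split.
    by apply: funext => -[|j] //=; rewrite fx // Ex taylor_t.
  exists (q' + q3), y; split=> //; last by move=> j jc; rewrite yP.
  rewrite embedD scalerDr Ex' Eq3 scalerA -exprD -to_generic_t -Ez -to_genericD.
  by rewrite addrC subrK.
- move=> f f0; exists (g 0), 0, 0; split=> //.
    by rewrite embed0 scaler0 to_generic0.
  by move=> j jc; rewrite f0 // taylor0.
Qed.

End Degeneration.

Lemma degenerates_lattice (k : fieldType) (R : algType k) (M N : lmodType R) :
  fin_gen M -> degenerates M N -> lattice_degenerates M N.
Proof.
move=> fgM [Q [fgQ Qflat [fib [fib' fibK fib'K]] [phi phi_bij]]].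
have Qt : forall q : Q, tens_t R *: q = 0 -> q = 0.
  exact: (flat_torsion_free (@loc0_t_mul_inj k) Qflat).
have pi0 : \pi_(quotmod (tsub Q)) 0 = 0 by rewrite !piE.
pose g (q : Q) : N := fib (\pi_(quotmod (tsub Q)) q).
apply: (@degeneration_lattice k R M N Q Qt phi phi_bij g) => //.
- by move=> x y; rewrite /g quotmodD linearD.
- by move=> r q; rewrite /g quotmodZ -linearZ.
- by move=> n; exists (repr (fib' n : quotmod (tsub Q)));
  rewrite /g reprK fib'K.
- move=> q; rewrite /g -(linear0 fib); congr (fib _).
  rewrite -[0 in RHS]pi0.
  by apply/quotmodP/tsub_predP; exists q; rewrite subr0.
- move=> q; rewrite /g -(linear0 fib) => /(can_inj fibK) q0.
  suff /quotmodP/tsub_predP[q' Eq'] :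
      \pi_(quotmod (tsub Q)) q = \pi_(quotmod (tsub Q)) 0.
    by exists q'; rewrite -Eq' subr0.
  by rewrite q0 pi0.
Qed.

(** * The Kuratowski closure and its topology *)

Lemma degeneratesP (k : fieldType) (R : algType k) (M N : lmodType R) :
  fin_gen M -> fin_gen N -> degenerates M N <-> lattice_degenerates M N.
Proof.
move=> fgM fgN; split; first exact: degenerates_lattice.
by move=> [m [D DL]]; apply: (lattice_graph_degenerates DL).
Qed.

Local Open Scope classical_set_scope.

Section ClosureTopology.
Variables (T : choiceType) (c : set T -> set T).
Hypotheses (c0 : c set0 = set0) (c_ext : forall X, X `<=` c X)
  (cU : forall X Y, c (X `|` Y) = c X `|` c Y).

Lemma closure_mono X Y : X `<=` Y -> c X `<=` c Y.
Proof. by move=> /setUidPr XY; rewrite -XY cU; exact: subsetUl. Qed.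

Definition closure_open : set (set T) := [set X | c (~` X) = ~` X].

Fact closure_openT : closure_open setT.
Proof. by rewrite /closure_open /= setCT. Qed.

Fact closure_openI : setI_closed closure_open.
Proof. by move=> X Y; rewrite /closure_open /= setCI cU => -> ->. Qed.

(** By monotonicity an intersection of closed sets is closed. *)
Fact closure_open_bigU (I : Type) (f : I -> set T) :
  (forall i, closure_open (f i)) -> closure_open (\bigcup_i f i).
Proof.
move=> fo; apply/seteqP; split=> [x|]; last exact: c_ext.
rewrite setC_bigcup => cx i _; rewrite -fo; apply: closure_mono cx => y.
exact.
Qed.

(** A copy of [T], on which the topology can depend on [c]. *)
Definition closure_space : Type := T.
HB.instance Definition _ := Choice.on closure_space.
HB.instance Definition _ := isOpenTopological.Build closure_space
  closure_openT closure_openI closure_open_bigU.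

Definition closure_topology : topology T := Topological.class closure_space.

Lemma closure_topology_openE (X : set (tspace closure_topology)) :
  open X = (c (~` X) = ~` X).
Proof. by []. Qed.

Lemma closure_topology_closedP (X : set (tspace closure_topology)) :
  closed X <-> c X = X.
Proof.
by rewrite -[X in closed X]setCK closedC closure_topology_openE setCK.
Qed.

End ClosureTopology.

Lemma closed_relativeP (T : topologicalType) (E : set T) (A : set E) :
  closed A <-> exists2 Z : set T, closed Z & set_val @` A = E `&` Z.
Proof.
rewrite -[A in closed A]setCK closedC; split.
  move=> [B Bo BA]; exists (~` B); first exact: open_closedC.
  apply/seteqP; split=> [_ [x Ax <-]|x [Ex nBx]].
    split; first exact: set_valP.
    by move=> Bx; have : (~` A) x by rewrite -BA.
  exists (SigSub (mem_set Ex)) => //; apply: contrapT => nA.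
  by apply: nBx; have : (~` A) (SigSub (mem_set Ex)) by []; rewrite -BA.
move=> [Z Zc AZ]; exists (~` Z); first exact: closed_openC.
apply/seteqP; split=> x /=.
  move=> nZ Ax; apply: nZ.
  by have [] : (E `&` Z) (set_val x) by rewrite -AZ; exists x.
move=> nA Zx; have : (E `&` Z) (set_val x) by split=> //; exact: set_valP.
by rewrite -AZ => -[y Ay /val_inj yx]; apply: nA; rewrite -yx.
Qed.

Section Kuratowski.
Variables (k : fieldType) (R : algType k).
Implicit Types X Y : set (iso_class R).

Lemma kuratowskiP X y : kuratowski X y <-> exists2 x, X x &
  exists2 n, (0 < n)%N &
  lattice_degenerates ({ffun 'I_n -> class_mod x} : lmodType R)
                      ({ffun 'I_n -> class_mod y} : lmodType R).
Proof.
have fg n (z : iso_class R) : fin_gen ({ffun 'I_n -> class_mod z} : lmodType R).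
  exact/fin_gen_ffun/class_mod_fin_gen.
by split=> -[x Xx [n n0 h]]; exists x => //; exists n => //; apply/degeneratesP.
Qed.

Lemma kuratowski0 : kuratowski (@set0 (iso_class R)) = set0.
Proof. by apply/seteqP; split=> // y [x []]. Qed.

Lemma kuratowski_ext X : X `<=` kuratowski X.
Proof.
move=> x Xx; apply/kuratowskiP; exists x => //; exists 1%N => //.
exact: lattice_degenerates_refl.
Qed.

Lemma kuratowskiU X Y : kuratowski (X `|` Y) = kuratowski X `|` kuratowski Y.
Proof.
apply/seteqP; split=> [y [x [Xx|Yx] h]|y [[x Xx h]|[x Yx h]]].
- by left; exists x.
- by right; exists x.
- by exists x => //; left.
- by exists x => //; right.
Qed.

Lemma lattice_degenerates_power n p (M N : lmodType R) :
  lattice_degenerates ({ffun 'I_n -> M} : lmodType R)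
                      ({ffun 'I_n -> N} : lmodType R) ->
  lattice_degenerates ({ffun 'I_(n * p) -> M} : lmodType R)
                      ({ffun 'I_(n * p) -> N} : lmodType R).
Proof.
move=> /(lattice_degenerates_ffun p).
by apply: lattice_degenerates_iso; apply: ffun_ffun_iso.
Qed.

(** If [z^p] degenerates to [x^p] and [x^n] to [y^n], then both hold for the
    exponent [pn] and compose. *)
Lemma kuratowskiK X : kuratowski (kuratowski X) = kuratowski X.
Proof.
apply/seteqP; split; last exact: kuratowski_ext.
move=> y /kuratowskiP[x /kuratowskiP[z Xz [p p0 zx]] [n n0 xy]].
apply/kuratowskiP; exists z => //; exists (p * n)%N;
  first by rewrite muln_gt0 p0.
apply: (lattice_degenerates_trans (lattice_degenerates_power n zx)).
by have := lattice_degenerates_power p xy; rewrite mulnC.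
Qed.

End Kuratowski.

Theorem theorem1p1 (k : fieldType) (R : algType k) :
  [/\ kuratowski (@set0 (iso_class R)) = set0,
      forall X : set (iso_class R), X `<=` kuratowski X,
      forall X Y : set (iso_class R),
        kuratowski (X `|` Y) = kuratowski X `|` kuratowski Y
    & forall X : set (iso_class R),
        kuratowski (kuratowski X) = kuratowski X] /\
  exists tau : topology (iso_class R),
    (forall X : set (tspace tau),
       (closed X <-> kuratowski X = X) /\
       (closed X <-> exists Y : set (iso_class R), X = kuratowski Y)) /\
    (forall m : idealr R, CM_local m -> coefficient_field m ->
       forall d : nat, (0 < d)%N ->
       let E : set (tspace tau) := MCM_classes m d in
       forall A : set E,
         closed A <->
         exists Y : set (iso_class R), set_val @` A = E `&` kuratowski Y).
Proof.
split.
  split; [exact: kuratowski0|exact: kuratowski_ext|exact: kuratowskiU|].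
  exact: kuratowskiK.
pose tau := closure_topology (@kuratowski0 k R) (@kuratowski_ext k R)
  (@kuratowskiU k R).
have closedP (X : set (tspace tau)) : closed X <-> kuratowski X = X.
  exact: closure_topology_closedP.
have closed_im (X : set (tspace tau)) :
    closed X <-> exists Y : set (iso_class R), X = kuratowski Y.
  split=> [/closedP KX|[Y ->]]; first by exists X.
  exact/closedP/kuratowskiK.
exists tau; split=> // m _ _ d _ E A.
split=> [/closed_relativeP[Z /closed_im[Y ->] AY]|[Y AY]]; first by exists Y.
by apply/closed_relativeP; exists (kuratowski Y) => //; apply/closed_im;
  exists Y.
Qed.
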